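(* Let $\rho$ be the largest eigenvalue (Perron-Frobenius eigenvalue) of the non-negative matrix $P^{(-)}$ associated with $(S,\mu)$, $(E,\mathcal{E},\nu)$ and $\phi$. Then: (i) if $2\rho<1$, the recursive tree process is endogenous; (ii) if $2\rho>1$, the recursive tree process is not endogenous; (iii) if $2\rho=1$ and, in addition, $\mathcal{H}_0\cap\mathcal{K}^{\perp}=\{0\}$ and $P^{(-)}$ is irreducible, then the recursive tree process is endogenous.
   Context: Setting. $S$ is a finite non-empty set (with the $\sigma$-algebra of all subsets), $\mu$ is a probability measure on $S$ with $\mu(x)>0$ for every $x\in S$, $(E,\mathcal{E},\nu)$ is a probability space, and $\phi:S\times S\times E\to S$ is a measurable map, symmetric in its first two arguments ($\phi(x_0,x_1,z)=\phi(x_1,x_0,z)$), under which the image of $\mu\otimes\mu\otimes\nu$ is $\mu$. Tree. $\Gamma_\infty=\bigcup_{k\ge 0}\{0,1\}^k$ is the vertex set of the infinite rooted binary tree with root $\emptyset$; $G_n=\{0,1\}^n$, $\Gamma_n=\bigcup_{k=0}^n G_k$ and $\Gamma_{-1}=\varnothing$. A vertex $u$ has the two daughters $u0$ and $u1$. Let $(\xi_u)_{u\in\Gamma_\infty}$ and $(\epsilon_u)_{u\in\Gamma_\infty}$ be the coordinate maps on $S^{\Gamma_\infty}\times E^{\Gamma_\infty}$, let $$\Omega=\{\omega: \xi_u(\omega)=\phi(\xi_{u0}(\omega),\xi_{u1}(\omega),\epsilon_u(\omega))\text{ for every }u\in\Gamma_\infty\},$$ let $\mathcal{F}$ be the restriction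 of the product $\sigma$-algebra to $\Omega$, and let $m$ be the unique probability measure on $(\Omega,\mathcal{F})$ such that for each $n\geq 0$ the joint law of $(\xi_u)_{u\in G_n}$ and $(\epsilon_u)_{u\in\Gamma_{n-1}}$ is the product measure $\bigotimes_{G_n}\mu\otimes\bigotimes_{\Gamma_{n-1}}\nu$. Endogeny. The recursive tree process is endogenous if every random variable on $(\Omega,\mathcal{F})$ is $m$-almost surely equal to a function measurable with respect to $\sigma(\epsilon_u;u\in\Gamma_\infty)$. Spaces. $\mathcal{H}=L^2(\Omega,\mathcal{F},m)$; $\mathcal{K}\subseteq\mathcal{H}$ is the closed subspace of (classes of) random variables measurable with respect to $\sigma(\epsilon_u;u\in\Gamma_\infty)$; $\mathcal{H}_0\subseteq\mathcal{H}$ is the subspace of random variables of the form $f(\xi_\emptyset)$ with $f:S\to\mathbb{R}$. Matrix. $P^{(2)}$ is the transition matrix on $S^2$ given by $$P^{(2)}((x,x'),(y,y'))=\sum_{x_1\in S}\mu(x_1)\,\nu\{z\in E:\phi(x,x_1,z)=y,\ \phi(x',x_1,z)=y'\}.$$ The diagonal $S^{\nearrow}=\{(x,x):x\in S\}$ is absorbing for $P^{(2)}$, and $P^{(-)}$ is the restriction of $P^{(2)}$ to $(S^2\setminus S^{\nearrow})\times(S^2\setminus S^{\nearrow})$. (If $|S|=1$, $P^{(-)}$ is empty and $\rho=0$ by convention.) *)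

(* Defs.v *)
From HB Require Import structures.
From mathcomp Require Import all_boot all_order all_algebra.
From mathcomp Require Import all_classical all_reals all_analysis.

Set Implicit Arguments.
Unset Strict Implicit.
Unset Printing Implicit Defensive.

Import Order.TTheory GRing.Theory Num.Theory.
Import numFieldNormedType.Exports.

Local Open Scope classical_set_scope.
Local Open Scope ring_scope.

(* Finite non-empty sets with the sigma-algebra of all subsets; non-emptiness
   comes from the pointedness of measurable types. *)
HB.mixin Record isDiscreteMeasurable (d : measure_display) T
    & Measurable d T := {
  discrete_measurableP : forall A : set T, d.-measurable A
}.

#[short(type="finMeasurableType")]
HB.structure Definition FinMeasurable (d : measure_display) :=
  {T of Finite T & Measurable d T & isDiscreteMeasurable d T}.

Record rtp (R : realType) (dS dE : measure_display)
    (S : finMeasurableType dS) (E : measurableType dE) := Rtp {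
  rtp_mu : probability S R;
  rtp_nu : probability E R;
  rtp_phi : S -> S -> E -> S;
  rtp_mu_gt0 : forall x : S, (0 < rtp_mu [set x])%E;
  rtp_phi_measurable :
    measurable_fun [set: S * S * E] (fun p => rtp_phi p.1.1 p.1.2 p.2);
  rtp_phi_sym : forall x0 x1 z, rtp_phi x0 x1 z = rtp_phi x1 x0 z;
  rtp_phi_image : forall A : set S, measurable A ->
    pushforward ((rtp_mu \x rtp_mu) \x rtp_nu)%E
      (fun p : S * S * E => rtp_phi p.1.1 p.1.2 p.2) A = rtp_mu A
}.

(* The vertex u of the binary tree is the word u : seq bool; its daughters
   u0 and u1 are obtained by appending a letter on the right. *)
Record Omega (R : realType) (dS dE : measure_display)
    (S : finMeasurableType dS) (E : measurableType dE) (D : rtp R S E) := MkOmega {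
  xi : seq bool -> S;
  eps : seq bool -> E;
  OmegaP : forall u,
    xi u = rtp_phi D (xi (rcons u false)) (xi (rcons u true)) (eps u)
}.

Section Omega_measurable.
Context (R : realType) (dS dE : measure_display).
Context (S : finMeasurableType dS) (E : measurableType dE) (D : rtp R S E).

(* mu charges every point, so every state is a value of phi; a configuration
   is then built from the root downwards. *)
Lemma rtp_phi_onto (x : S) : exists p : S * S * E,
  rtp_phi D p.1.1 p.1.2 p.2 = x.
Proof.
apply: contrapT => nx.
have := rtp_mu_gt0 D x.
rewrite -(rtp_phi_image D (discrete_measurableP [set x])) /pushforward.
rewrite (_ : _ @^-1` _ = set0) ?measure0 ?ltxx //.
by apply/seteqP; split=> // p /= px; apply: nx; exists p.
Qed.

Lemma Omega_inhabited : inhabited (Omega D).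
Proof.
have [g gE] := choice rtp_phi_onto.
pose next x b := if b then (g x).1.2 else (g x).1.1.
pose st u := foldl next (point : S) u.
exists; apply: (@MkOmega _ _ _ _ _ D st (fun u => (g (st u)).2)) => u.
by rewrite /st !foldl_rcons /= gE.
Qed.

HB.instance Definition _ := gen_eqMixin (Omega D).
HB.instance Definition _ := gen_choiceMixin (Omega D).
HB.instance Definition _ :=
  isPointed.Build (Omega D) (inhabited_witness Omega_inhabited).

Definition xi_events : set (set (Omega D)) :=
  \bigcup_u preimage_set_system setT (fun w => xi w u) measurable.

Definition eps_events : set (set (Omega D)) :=
  \bigcup_u preimage_set_system setT (fun w => eps w u) measurable.

(* The trace on Omega of the product sigma-algebra is the sigma-algebra
   generated by the restrictions to Omega of the coordinate maps. *)
Definition Omega_measurable : set (set (Omega D)) :=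
  <<s xi_events `|` eps_events >>.

HB.instance Definition _ :=
  @isMeasurable.Build (sigma_display (xi_events `|` eps_events)) (Omega D)
    Omega_measurable (@sigma_algebra0 _ setT (xi_events `|` eps_events))
    (@sigma_algebraC (Omega D) (xi_events `|` eps_events))
    (@sigma_algebra_bigcup _ setT (xi_events `|` eps_events)).

End Omega_measurable.

Section rtp_defs.
Context (R : realType) (dS dE : measure_display).
Context (S : finMeasurableType dS) (E : measurableType dE) (D : rtp R S E).

(* For each n, the joint law of (xi_u)_{u in G_n} and (eps_u)_{u in Gamma_(n-1)}
   is the product measure, given by its values on measurable rectangles; a
   vertex of generation k is a k.-tuple bool. *)
Definition is_rtp_law (m : probability (Omega D) R) : Prop :=
  forall (n : nat) (A : seq bool -> set S) (B : seq bool -> set E),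
    (forall u, measurable (A u)) -> (forall u, measurable (B u)) ->
    m [set w | (forall u : seq bool, size u = n -> A u (xi w u)) /\
               (forall u : seq bool, (size u < n)%N -> B u (eps w u))] =
    ((\prod_(u : n.-tuple bool) rtp_mu D (A u)) *
     (\prod_(k < n) \prod_(u : k.-tuple bool) rtp_nu D (B u)))%E.

Definition eps_measurable (Y : Omega D -> R) : Prop :=
  @measurable_fun _ _ (g_sigma_algebraType (@eps_events R dS dE S E D)) R setT Y.

Definition endogenous (m : probability (Omega D) R) : Prop :=
  forall X : {RV m >-> R},
    exists2 Y : Omega D -> R, eps_measurable Y & X = Y %[ae m].

(* Elements of L^2 are handled through representatives: the sets below consist
   of square-integrable functions and are saturated for a.e. equality. *)
Definition L2 (m : probability (Omega D) R) : set (Omega D -> R) :=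
  [set X | X \in Lfun m 2%:E].

Definition L2_eps (m : probability (Omega D) R) : set (Omega D -> R) :=
  [set X | L2 m X /\ exists2 Y, eps_measurable Y & X = Y %[ae m]].

Definition L2_root (m : probability (Omega D) R) : set (Omega D -> R) :=
  [set X | L2 m X /\ exists f : S -> R, X = (fun w => f (xi w [::])) %[ae m]].

Definition L2_zero (m : probability (Omega D) R) : set (Omega D -> R) :=
  [set X | L2 m X /\ X = cst 0 %[ae m]].

Definition L2_orth (m : probability (Omega D) R) (K : set (Omega D -> R)) :
    set (Omega D -> R) :=
  [set X | L2 m X /\ forall Y, K Y -> ('E_m[X \* Y] = 0)%E].

Definition P2 (p q : S * S) : R :=
  \sum_(x1 : S) fine (rtp_mu D [set x1]) *
    fine (rtp_nu D [set z | rtp_phi D p.1 x1 z = q.1 /\ rtp_phi D p.2 x1 z = q.2]).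

Definition offdiag := {p : S * S | p.1 != p.2}.

Definition Pminus : 'M[R]_#|{: offdiag}| :=
  \matrix_(i, j) P2 (val (enum_val i)) (val (enum_val j)).

End rtp_defs.

Definition irreducible_mx (R : realType) (n : nat) (A : 'M[R]_n) : Prop :=
  forall i j, exists2 k, (0 < k)%N & 0 < (A ^+ k) i j.

(* A matrix has finitely many eigenvalues, so this is a maximum as soon as there
   is a real eigenvalue (largest_eigenvalueP), which for a non-negative matrix of
   positive size holds by Perron-Frobenius; the maximum is then the spectral
   radius. For the empty matrix the value is sup set0 = 0. *)
Definition largest_eigenvalue (R : realType) (n : nat) (A : 'M[R]_n) : R :=
  sup [set a | eigenvalue A a].

Lemma largest_eigenvalueP (R : realType) (n : nat) (A : 'M[R]_n) (a0 : R) :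
  eigenvalue A a0 ->
  eigenvalue A (largest_eigenvalue A) /\
  forall a, eigenvalue A a -> a <= largest_eigenvalue A.
Proof.
move=> ea0.
have [s [sA As]] : exists s : seq R,
    all (eigenvalue A) s /\ forall a, eigenvalue A a -> a \in s.
  pose P k := `[< exists s : seq R, [/\ size s = k, uniq s & all (eigenvalue A) s] >].
  have P0 : exists k, P k by exists 0%N; apply/asboolP; exists [::].
  have Pub k : P k -> (k <= size (char_poly A))%N.
    move=> /asboolP[s [<- us sA]]; apply: ltnW; apply: max_poly_roots => //.
      exact/monic_neq0/char_poly_monic.
    by apply: sub_all sA => a; rewrite eigenvalue_root_char.
  have [k /asboolP[s [sk us sA]] kmax] := ex_maxnP P0 Pub.
  exists s; split=> // a ea; apply: contraT => nas.
  have : P k.+1.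
    by apply/asboolP; exists (a :: s); rewrite /= sk nas us ea sA.
  by move/kmax; rewrite ltnn.
have ub : has_ubound [set a | eigenvalue A a].
  exists (\big[Num.max/a0]_(a <- s) a) => a /= /As; move=> h; exact: (@le_bigmax_seq _ _ _ s a0 _ xpredT id h isT).
have le_sup a : eigenvalue A a -> a <= largest_eigenvalue A.
  by move=> ea; apply: ub_le_sup.
split=> //.
pose M := \big[Num.max/a0]_(a <- s) a.
have eM : eigenvalue A M.
  rewrite /M; elim: s sA {As ub M} => [|a s IH] /=; first by rewrite big_nil.
  by move=> /andP[ea /IH es]; rewrite big_cons; case: (leP a _).
suff -> : largest_eigenvalue A = M by [].
apply/eqP; rewrite eq_le le_sup// andbT; apply: ge_sup; first by exists a0.
by move=> a /= /As; move=> h; exact: (@le_bigmax_seq _ _ _ s a0 _ xpredT id h isT).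
Qed.

(* Main.v *)
(* Only the random maps g_u = phi(., ., eps_u), which take finitely many values,
   matter. Let l_n be the law of the pair of root values of two depth-n trees
   sharing their innovations and having independent leaves; l_0 = mu x mu and
   l_(n+1) = T l_n for a quadratic operator T. The process is endogenous iff the
   mass of l_n off the diagonal tends to 0 (for "if", guess the most likely root
   value given the innovations and use Borel-Cantelli; for "only if", approximate
   the events of the innovation sigma-algebra by cylinders).

   If d is a pseudometric, changing the two daughters one after the other and the
   triangle inequality give <T l, d> <= 2 <l, P d>, where P = P^(2). A positive
   vector v with P^(-) v <= th v yields a metric d with P d <= th d, namely the
   largest pseudometric below v. For 2 th < 1, <l_n, d> decays geometrically. For
   2 th = 1 it is nonincreasing, and the defect in the triangle inequality is at
   least l(a, a')^2 E d(g(a, a'), g(a', a')), by the symmetry of g applied to the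
   pairs (a, a') and (a', a). For some a, a' this expectation is positive, as
   otherwise P^(-) = 0; hence l_n(a, a') -> 0, and irreducibility propagates this
   to all pairs.

   Conversely <T l, v> >= 2 c <l, P v> as soon as l(b, b) >= c mu(b) for all b. If
   l_n concentrated on the diagonal, c could be taken close to 1, and <l_n, v>
   would be nondecreasing and positive for the modulus v of an eigenvector with
   eigenvalue rho > 1/2, although v = 0 on the diagonal forces <l_n, v> -> 0. *)

Require Import Defs.
From HB Require Import structures.
From mathcomp Require Import all_boot all_order all_algebra.
From mathcomp Require Import all_classical all_reals all_analysis.
From mathcomp Require Import measurable_realfun ring lra.

Set Implicit Arguments.
Unset Strict Implicit.
Unset Printing Implicit Defensive.

Import Order.TTheory GRing.Theory Num.Theory.
Import numFieldNormedType.Exports.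

Local Open Scope classical_set_scope.
Local Open Scope ring_scope.

(** * Finite sums over products *)

Lemma big_pair (R : nmodType) (I J : finType) (F : I * J -> R) :
  \sum_p F p = \sum_i \sum_j F (i, j).
Proof. by rewrite pair_bigA; apply: eq_bigr => -[]. Qed.

Lemma mulr_sum2 (R : pzSemiRingType) (I J : finType) (F : I -> R) (H : J -> R) :
  \sum_i \sum_j F i * H j = (\sum_i F i) * (\sum_j H j).
Proof. by rewrite mulr_suml; apply: eq_bigr => i _; rewrite mulr_sumr. Qed.

Lemma sum_delta (R : pzSemiRingType) (I : finType) (w : I -> R) i : \sum_j w j * (j == i)%:R = w i.
Proof.
rewrite (bigD1 i)//= eqxx mulr1 big1 ?addr0// => j /negbTE ->.
by rewrite mulr0.
Qed.

(** * Nonnegative matrices *)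

(** The witness is the inverse of a sum rather than a minimum, so that an empty [T] needs no
    separate case. *)
Lemma finite_pos_lbound (R : realType) (T : finType) (f : T -> R) :
  (forall i, 0 < f i) -> exists2 e, 0 < e & forall i, e <= f i.
Proof.
move=> f0; exists (1 + \sum_i (f i)^-1)^-1 => [|i].
  by rewrite invr_gt0 ltr_pwDl// sumr_ge0// => i _; rewrite invr_ge0 ltW.
rewrite -[leRHS]invrK lef_pV2 ?posrE ?invr_gt0//.
  by rewrite (bigD1 i)//= addrCA lerDl addr_ge0// sumr_ge0// => j _; rewrite invr_ge0 ltW.
by rewrite ltr_pwDl// sumr_ge0// => j _; rewrite invr_ge0 ltW.
Qed.

Section nonnegative_matrix.
Context (R : realType) (n : nat) (A : 'M[R]_n).
Hypothesis A_ge0 : forall i j, 0 <= A i j.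

Lemma mulmx_col_ge0 (m : nat) (B : 'M[R]_(m, n)) (x : 'cV[R]_n) :
  (forall i j, 0 <= B i j) -> (forall i, 0 <= x i 0) ->
  forall i, 0 <= (B *m x) i 0.
Proof. by move=> B0 x0 i; rewrite mxE sumr_ge0// => j _; rewrite mulr_ge0. Qed.

(** Minimum principle: let c be the least ratio y_k / x_k, attained at k. If c < 0, then s y_k = c s
    x_k < c (A x)_k <= (A y)_k, against the hypothesis on y. *)
Lemma strict_superharmonic_min (x y : 'cV[R]_n) (s : R) :
  (forall i, 0 < x i 0) -> (forall i, (A *m x) i 0 < s * x i 0) ->
  (forall i, (A *m y) i 0 <= s * y i 0) -> forall i, 0 <= y i 0.
Proof.
move=> x0 Ax Ay i.
case: (@arg_minP _ R _ i xpredT (fun j => y j 0 / x j 0) isT) => k _ kmin.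
have ck j : y k 0 / x k 0 * x j 0 <= y j 0 by rewrite -ler_pdivlMr// kmin.
suff c0 : 0 <= y k 0 / x k 0 by rewrite (le_trans _ (ck i))// mulr_ge0// ltW.
rewrite leNgt; apply/negP => c0; have := Ay k; apply/negP; rewrite -ltNge.
have -> : s * y k 0 = y k 0 / x k 0 * (s * x k 0).
  by rewrite mulrCA divfK// gt_eqF.
apply: (@lt_le_trans _ _ (y k 0 / x k 0 * (A *m x) k 0)).
  by rewrite ltr_nM2l.
rewrite !mxE mulr_sumr ler_sum// => j _.
by rewrite mulrCA ler_wpM2l.
Qed.

(* The infimum over the levels s >= t at which a strict supersolution exists is
   attained by the solution of (s - A) y = 1, and could be lowered if it were
   not t. *)
Lemma strict_superharmonic_exists (t : R) : 0 < t ->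
  (forall s, t <= s -> ~~ eigenvalue A s) ->
  exists x : 'cV[R]_n,
    (forall i, 0 < x i 0) /\ (forall i, (A *m x) i 0 < t * x i 0).
Proof.
move=> t0 At.
pose ok (s : R) := exists x : 'cV[R]_n,
    (forall i, 0 < x i 0) /\ (forall i, (A *m x) i 0 < s * x i 0).
pose T := [set s | t <= s /\ ok s].
have lbT : has_lbound T by exists t => s -[].
have T0 : T !=set0.
  (* The constant vector 1 is a strict supersolution at this level, as the sum of all entries bounds
     every row sum. *)
  exists (Num.max t (1 + \sum_i \sum_j A i j)); split.
    by rewrite le_max lexx.
  exists (const_mx 1); split=> i; rewrite ?mxE// mulr1 lt_max; apply/orP; right.
  under eq_bigr do rewrite mxE mulr1.
  rewrite ltr_pwDl// [leRHS](bigD1 i)//= lerDl.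
  by rewrite sumr_ge0// => k _; rewrite sumr_ge0.
pose s0 := inf T.
have ts0 : t <= s0 by apply: lb_le_inf => // s [].
have s00 : 0 < s0 := lt_le_trans t0 ts0.
have sU : s0%:M - A \in unitmx.
  have := At _ ts0; rewrite /eigenvalue /eigenspace negbK kermx_eq0.
  rewrite row_free_unit => AsU.
  by rewrite -[_ - A]opprB -scaleN1r unitmxZ// unitrN unitr1.
pose y : 'cV[R]_n := invmx (s0%:M - A) *m const_mx 1.
have yE i : s0 * y i 0 = 1 + (A *m y) i 0.
  have : ((s0%:M - A) *m y) i 0 = 1 by rewrite mulKVmx// mxE.
  rewrite mulmxBl mul_scalar_mx => /eqP; rewrite mxE [X in X + _]mxE [X in _ + X]mxE.
  by rewrite subr_eq => /eqP ->.
pose N := 1 + \sum_i `|y i 0|.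
have N0 : 0 < N by rewrite ltr_pwDl// sumr_ge0.
have yN i : `|y i 0| < N.
  by rewrite /N (bigD1 i)//= addrCA ltrDl ltr_pwDl// sumr_ge0.
have [s [ts [x [x0 Ax]]] ss0] : exists2 s, T s & s < s0 + N^-1.
  by apply: inf_adherent; rewrite ?invr_gt0.
have s0s : s0 <= s.
  by apply: ge_inf => //; split=> //; exists x.
have y0 : forall i, 0 <= y i 0.
  (* Here s y - A y = 1 + (s - s0) y is nonnegative, because |y| < N and 0 <= s - s0 < 1/N. *)
  apply: (strict_superharmonic_min x0 Ax) => i.
  have -> : (A *m y) i 0 = s0 * y i 0 - 1 by rewrite yE addrAC subrr add0r.
  rewrite lerBlDr -lerBlDl -mulrBl (le_trans (ler_norm _))// normrM.
  rewrite distrC [X in X * _]ger0_norm ?subr_ge0//.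
  rewrite -(mulVf (lt0r_neq0 N0)) ler_pM ?subr_ge0//; last exact: ltW.
  by rewrite lerBlDl ltW.
have yp i : 0 < y i 0.
  rewrite -(pmulr_rgt0 _ s00) yE ltr_pwDl//; exact: mulmx_col_ge0.
(* Since s0 y - A y = 1 and 0 < y < N, the same y is a strict supersolution at level s0 - 1/N. As s0
   is a lower bound, this forces s0 = t. *)
have okt : ok (Num.max t (s0 - N^-1)).
  exists y; split=> // i.
  apply: (@lt_le_trans _ _ ((s0 - N^-1) * y i 0)).
    rewrite mulrBl yE addrAC ltrDr subr_gt0 mulrC ltr_pdivrMr// mul1r.
    exact: le_lt_trans (ler_norm _) (yN i).
  by rewrite ler_pM2r// le_max lexx orbT.
have : s0 <= Num.max t (s0 - N^-1) by apply: ge_inf => //; split=> //; rewrite le_max lexx.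
rewrite le_max lerDl oppr_ge0 => /orP[s0t|]; last by rewrite leNgt invr_gt0 N0.
move: okt; rewrite max_l// (le_trans _ s0t)// gerDl oppr_le0 invr_ge0; exact: ltW.
Qed.

(** The minimum principle, applied to -z. *)
Lemma subharmonic_le0 (t : R) (z : 'cV[R]_n) : 0 < t ->
  (forall s, t <= s -> ~~ eigenvalue A s) ->
  (forall i, t * z i 0 <= (A *m z) i 0) -> forall i, z i 0 <= 0.
Proof.
move=> t0 At tz i; have [x [x0 Ax]] := strict_superharmonic_exists t0 At.
rewrite -oppr_ge0.
have -> : - z i 0 = (- z) i 0 by rewrite mxE.
apply: (strict_superharmonic_min x0 Ax) => j.
by rewrite mulmxN [leLHS]mxE [(- z) j 0]mxE mulrN lerN2.
Qed.

(** [eigenvalue] refers to row eigenvectors, while functions on pairs are columns here. *)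
Lemma eigenvalue_trmx (a : R) : eigenvalue A^T a = eigenvalue A a.
Proof.
rewrite /eigenvalue /eigenspace !kermx_eq0 !row_free_unit -(unitmx_tr (A - _)).
by rewrite linearB/= tr_scalar_mx.
Qed.

(** The moduli of an eigenvector u of the transpose work: a |u_i| = |sum_j A_ij u_j| <= sum_j A_ij
    |u_j|. *)
Lemma eigenvalue_subharmonic (a : R) : 0 <= a -> eigenvalue A a ->
  exists w : 'cV[R]_n, [/\ forall i, 0 <= w i 0, w != 0 &
    forall i, a * w i 0 <= (A *m w) i 0].
Proof.
move=> a0; rewrite -eigenvalue_trmx => /eigenvalueP[u uA u0].
exists (\col_i `|u 0 i|); split=> [i||i]; first by rewrite mxE.
  apply: contraNneq u0 => /matrixP u0; apply/eqP/rowP => i.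
  by apply/eqP; have := u0 i 0; rewrite !mxE => /normr0P.
have := congr1 (fun x : 'rV_n => `|x 0 i|) uA; rewrite !mxE normrM ger0_norm// => <-.
rewrite (le_trans (ler_norm_sum _ _ _))// ler_sum// => j _.
by rewrite !mxE normrM [`|A i j|]ger0_norm// mulrC.
Qed.

(** Irreducibility makes B, a sum of powers of A, positive in every entry. If the subsolution w were
    not an eigenvector, z = B w would satisfy A z >= (a + e) z with e > 0, which [subharmonic_le0]
    excludes above the largest eigenvalue. So A w = a w, and the positive vector B w is a positive
    multiple of w. *)
Lemma perron_irreducible (a : R) : 0 < a -> irreducible_mx A ->
  eigenvalue A a -> (forall s, a < s -> ~~ eigenvalue A s) ->
  exists v : 'cV[R]_n,
    (forall i, 0 < v i 0) /\ (forall i, (A *m v) i 0 = a * v i 0).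
Proof.
move=> a0 Airr /(eigenvalue_subharmonic (ltW a0))[w [w0 wn0 aw]] Aa.
have [k kP] : exists k : 'I_n * 'I_n -> nat, forall p, 0 < (A ^+ k p) p.1 p.2.
  have /choice[k kP] : forall p : 'I_n * 'I_n, exists l, 0 < (A ^+ l) p.1 p.2.
    by move=> p; have [l] := Airr p.1 p.2; exists l.
  by exists k.
pose K := (\sum_p k p).+1.
pose B : 'M[R]_n := \sum_(l < K) A ^+ l.
have AX0 l i j : 0 <= (A ^+ l) i j.
  elim: l i j => [|l IH] i j; first by rewrite expr0 mxE ler0n.
  by rewrite exprS mxE sumr_ge0// => m _; rewrite mulr_ge0.
have B0 i j : 0 < B i j.
  have kK : (k (i, j) < K)%N by rewrite ltnS (bigD1 (i, j))//= leq_addr.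
  rewrite /B summxE (bigD1 (Ordinal kK))//=.
  by apply: ltr_pwDl; [exact: (kP (i, j)) | rewrite sumr_ge0].
have Bpos (y : 'cV[R]_n) : (forall i, 0 <= y i 0) -> y != 0 -> forall i, 0 < (B *m y) i 0.
  move=> y0 /eqP yn0 i; have [j yj] : exists j, y j 0 != 0.
    apply: contrapT => /forallNP y_eq0; apply: yn0; apply/colP => j.
    by rewrite mxE; apply/eqP/negPn/negP/y_eq0.
  rewrite mxE (bigD1 j)//=; apply: ltr_pwDl.
    by rewrite mulr_gt0// lt_neqAle y0 eq_sym yj.
  by rewrite sumr_ge0// => m _; rewrite mulr_ge0// ltW.
have BA : B *m A = A *m B.
  by rewrite /B !mulmxE mulr_suml mulr_sumr; apply: eq_bigr => l _; rewrite -exprS -exprSr.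
have w_harm : A *m w = a *: w.
  apply/eqP; rewrite -subr_eq0; apply: contraT => yn0.
  have y0 i : 0 <= (A *m w - a *: w) i 0.
    by rewrite mxE [(- (a *: w)) i 0]mxE [(a *: w) i 0]mxE subr_ge0.
  pose z := B *m w.
  have z0 i : 0 < z i 0 by apply: Bpos.
  have zE i : (A *m z) i 0 = a * z i 0 + (B *m (A *m w - a *: w)) i 0.
    have -> : B *m (A *m w - a *: w) = A *m z - a *: z.
      by rewrite mulmxBr mulmxA -scalemxAr BA -mulmxA.
    by rewrite [X in _ = _ + X]mxE [(- (a *: z)) i 0]mxE [(a *: z) i 0]mxE subrKC.
  have [e e0 eP] := finite_pos_lbound (fun i => divr_gt0 (Bpos _ y0 yn0 i) (z0 i)).
  have z_le0 : forall i, z i 0 <= 0.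
    apply: (@subharmonic_le0 (a + e)) => [|s aes|i]; first exact: addr_gt0.
      by apply: Aa; apply: lt_le_trans aes; rewrite ltrDl.
    by rewrite zE mulrDl lerD2l -ler_pdivlMr.
  have [i wi] : exists i : 'I_n, True.
    apply: contrapT => /forallNP ni; move/negP: wn0; apply; apply/eqP/colP => i.
    by have := ni i.
  by have := z_le0 i; rewrite leNgt z0.
exists w; split=> i; last by rewrite w_harm mxE.
have Bw : B *m w = (\sum_(l < K) a ^+ l) *: w.
  rewrite mulmx_suml scaler_suml; apply: eq_bigr => l _.
  elim: (l : nat) => [|q IH]; first by rewrite !expr0 mul1mx scale1r.
  by rewrite exprS -mulmxE -mulmxA IH -scalemxAr w_harm scalerA exprSr.
have := Bpos _ w0 wn0 i; rewrite Bw mxE pmulr_rgt0//.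
rewrite lt_neqAle eq_sym sumr_ge0 ?andbT//; last by move=> *; rewrite exprn_ge0// ltW.
by rewrite big_ord_recl expr0 gt_eqF// ltr_pwDl// sumr_ge0// => *; rewrite exprn_ge0// ltW.
Qed.

End nonnegative_matrix.

(** * The recursion for pairs of trees *)

Section recursive_coupling.
Context (R : realType) (T : finType).
Notation G := {ffun T * T -> T}.
Context (mu : T -> R) (nu : G -> R).

(** An innovation is recorded through the map that it induces on pairs of states, so that a tree of
    depth n has finitely many configurations: maps at generations 0 to n-1, states at generation
    n. *)
Fixpoint innov (n : nat) : finType :=
  if n is k.+1 then (G * (innov k * innov k))%type : finType else unit : finType.

Fixpoint leaves (n : nat) : finType :=
  if n is k.+1 then (leaves k * leaves k)%type : finType else T.

Fixpoint innov_weight n : innov n -> R :=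
  match n with
  | 0 => fun=> 1
  | k.+1 => fun g : innov k.+1 =>
      nu g.1 * (innov_weight g.2.1 * innov_weight g.2.2)
  end.

Fixpoint leaves_weight n : leaves n -> R :=
  match n with
  | 0 => mu
  | k.+1 => fun s : leaves k.+1 => leaves_weight s.1 * leaves_weight s.2
  end.

Fixpoint root_val n : innov n -> leaves n -> T :=
  match n with
  | 0 => fun=> id
  | k.+1 => fun (g : innov k.+1) (s : leaves k.+1) =>
      g.1 (root_val g.2.1 s.1, root_val g.2.2 s.2)
  end.

(** The conditional law of the root value given the innovations [g], the leaves being independent of
    law [mu]. *)
Definition cond_law n (g : innov n) (x : T) : R :=
  \sum_(s : leaves n) leaves_weight s * (root_val g s == x)%:R.

(* The law of the root values of two copies of the tree which share their
   innovations and have independent leaves. *)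
Definition coupling n (p : T * T) : R :=
  \sum_(g : innov n) innov_weight g * (cond_law g p.1 * cond_law g p.2).

(** The action of P^(2) on functions, with the innovation replaced by its induced map. *)
Definition pair_op (V : T * T -> R) (p : T * T) : R :=
  \sum_b mu b * \sum_(h : G) nu h * V (h (p.1, b), h (p.2, b)).

Definition pairing (l V : T * T -> R) : R := \sum_p l p * V p.

Hypothesis mu_gt0 : forall x, 0 < mu x.
Hypothesis mu_sum1 : \sum_x mu x = 1.
Hypothesis nu_ge0 : forall h, 0 <= nu h.
Hypothesis nu_sum1 : \sum_h nu h = 1.
Hypothesis nu_sym : forall h, nu h != 0 -> forall a b, h (a, b) = h (b, a).
Hypothesis mu_inv : forall x,
  \sum_(h : G) nu h * \sum_a \sum_b mu a * mu b * (h (a, b) == x)%:R = mu x.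

Lemma big_innov0 (F : innov 0 -> R) : \sum_g F g = F tt.
Proof. by rewrite (bigD1 tt)//= big1 ?addr0// => -[]. Qed.

Lemma innov_weight_ge0 n (g : innov n) : 0 <= innov_weight g.
Proof. by elim: n g => [|n IH] g //=; rewrite !mulr_ge0. Qed.

Lemma leaves_weight_ge0 n (s : leaves n) : 0 <= leaves_weight s.
Proof. by elim: n s => [|n IH] s /=; [exact/ltW | rewrite mulr_ge0]. Qed.

Lemma leaves_weight_sum1 n : \sum_(s : leaves n) leaves_weight s = 1.
Proof.
elim: n => [|n IH] //=; rewrite big_pair /=.
by rewrite (mulr_sum2 (@leaves_weight n) (@leaves_weight n)) IH mulr1.
Qed.

Lemma innov_weight_sum1 n : \sum_(g : innov n) innov_weight g = 1.
Proof.
elim: n => [|n IH] /=.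
  by rewrite sumr_const card_unit.
rewrite big_pair /= -[RHS]nu_sum1; apply: eq_bigr => h _.
rewrite -mulr_sumr big_pair /=.
by rewrite (mulr_sum2 (@innov_weight n) (@innov_weight n)) IH !mulr1.
Qed.

Lemma cond_law_ge0 n (g : innov n) x : 0 <= cond_law g x.
Proof. by rewrite sumr_ge0// => s _; rewrite mulr_ge0 ?leaves_weight_ge0. Qed.

Lemma cond_law_sum n (g : innov n) (F : T -> R) :
  \sum_x cond_law g x * F x = \sum_s leaves_weight s * F (root_val g s).
Proof.
under eq_bigr do rewrite mulr_suml.
rewrite exchange_big; apply: eq_bigr => s _ /=.
rewrite (bigD1 (root_val g s))//= eqxx mulr1 big1 ?addr0// => x.
by rewrite eq_sym => /negbTE ->; rewrite mulr0 mul0r.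
Qed.

Lemma cond_lawS_sum n (h : G) (g0 g1 : innov n) (F : T -> R) :
  \sum_x cond_law ((h, (g0, g1)) : innov n.+1) x * F x =
  \sum_a \sum_b cond_law g0 a * cond_law g1 b * F (h (a, b)).
Proof.
rewrite cond_law_sum big_pair /=.
under [RHS]eq_bigr do under eq_bigr do rewrite -mulrA.
under [RHS]eq_bigr do rewrite -mulr_sumr cond_law_sum.
rewrite cond_law_sum; apply: eq_bigr => s0 _.
by rewrite mulr_sumr; apply: eq_bigr => s1 _; rewrite mulrA.
Qed.

Lemma cond_law_sum1 n (g : innov n) : \sum_x cond_law g x = 1.
Proof.
under eq_bigr do rewrite -[cond_law _ _]mulr1.
rewrite (cond_law_sum g (fun=> 1)) -[RHS](leaves_weight_sum1 n).
by apply: eq_bigr => s _; rewrite mulr1.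
Qed.

(** Induction on the depth: the two subtrees are independent with roots of law [mu], and [mu_inv]
    handles the map at the root. *)
Lemma cond_law_mean n x : \sum_(g : innov n) innov_weight g * cond_law g x = mu x.
Proof.
have qE m (g : innov m) y :
    cond_law g y = \sum_z cond_law g z * (z == y)%:R by rewrite cond_law_sum.
elim: n x => [|n IH] x.
  rewrite big_innov0 /= mul1r /cond_law /=.
  rewrite (bigD1 x)//= eqxx mulr1 big1 ?addr0// => y /negbTE ->.
  by rewrite mulr0.
rewrite /= -[RHS]mu_inv big_pair /=; apply: eq_bigr => h _.
rewrite big_pair.
transitivity (nu h * \sum_(g0 : innov n) \sum_(g1 : innov n) \sum_a \sum_b
   (innov_weight g0 * cond_law g0 a) * (innov_weight g1 * cond_law g1 b) * (h (a, b) == x)%:R).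
  rewrite mulr_sumr; apply: eq_bigr => g0 _; rewrite mulr_sumr; apply: eq_bigr => g1 _.
  rewrite qE cond_lawS_sum /= -!mulrA; congr (_ * _).
  rewrite mulrA mulr_sumr; apply: eq_bigr => a _; rewrite mulr_sumr; apply: eq_bigr => b _.
  by ring.
congr (_ * _).
under [LHS]eq_bigr do rewrite exchange_big/=.
rewrite [LHS]exchange_big/=; apply: eq_bigr => a _.
under [LHS]eq_bigr do rewrite exchange_big/=.
rewrite [LHS]exchange_big/=; apply: eq_bigr => b _.
under [LHS]eq_bigr do rewrite -mulr_suml.
by rewrite -mulr_suml mulr_sum2 !IH.
Qed.

(** * The coupled law: marginals, symmetry and one step of the recursion *)

Lemma coupling_ge0 n p : 0 <= coupling n p.
Proof.
by rewrite sumr_ge0// => g _; rewrite !mulr_ge0 ?innov_weight_ge0 ?cond_law_ge0.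
Qed.

Lemma coupling_sym n a b : coupling n (a, b) = coupling n (b, a).
Proof. by apply: eq_bigr => g _ /=; rewrite [X in _ * X]mulrC. Qed.

Lemma coupling_marginal n x : \sum_y coupling n (x, y) = mu x.
Proof.
rewrite exchange_big -[RHS](cond_law_mean n); apply: eq_bigr => g _ /=.
by rewrite -mulr_sumr -mulr_sumr cond_law_sum1 mulr1.
Qed.

(** Nonnegativity of the variance of [cond_law g x], whose mean over [g] is [mu x]. *)
Lemma coupling_diag_ge n x : mu x ^+ 2 <= coupling n (x, x).
Proof.
have : 0 <= \sum_(g : innov n) innov_weight g * (cond_law g x - mu x) ^+ 2.
  by rewrite sumr_ge0// => g _; rewrite mulr_ge0 ?innov_weight_ge0// sqr_ge0.
have -> : \sum_(g : innov n) innov_weight g * (cond_law g x - mu x) ^+ 2 =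
    coupling n (x, x) - 2 * mu x * (\sum_(g : innov n) innov_weight g * cond_law g x) +
    mu x ^+ 2 * (\sum_(g : innov n) innov_weight g).
  rewrite !mulr_sumr -sumrB -big_split/=; apply: eq_bigr => g _ /=.
  by ring.
by rewrite cond_law_mean innov_weight_sum1; nra.
Qed.

Lemma coupling0 p : coupling 0 p = mu p.1 * mu p.2.
Proof.
have q0 x : cond_law (tt : innov 0) x = mu x.
  by rewrite -(cond_law_mean 0) big_innov0 /= mul1r.
by rewrite /coupling big_innov0 /= mul1r !q0.
Qed.

(** The quadratic recursion: p and r are the independent pairs of values at the first and second
    daughter, and h is the shared map at the root. *)
Lemma pairing_couplingS n (V : T * T -> R) :
  pairing (coupling n.+1) V = \sum_p \sum_r \sum_(h : G)
    coupling n p * coupling n r * (nu h * V (h (p.1, r.1), h (p.2, r.2))).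
Proof.
transitivity (\sum_(h : G) nu h * \sum_(g0 : innov n) \sum_(g1 : innov n)
   innov_weight g0 * innov_weight g1 * \sum_p \sum_r
     (cond_law g0 p.1 * cond_law g0 p.2) * (cond_law g1 r.1 * cond_law g1 r.2) *
     V (h (p.1, r.1), h (p.2, r.2))).
  rewrite /pairing /coupling; under eq_bigr do rewrite mulr_suml.
  rewrite exchange_big big_pair; apply: eq_bigr => h _ /=.
  rewrite big_pair mulr_sumr; apply: eq_bigr => g0 _.
  rewrite mulr_sumr; apply: eq_bigr => g1 _ /=.
  under eq_bigr do rewrite -mulrA -mulrA.
  rewrite -mulr_sumr -mulr_sumr; congr (_ * (_ * _)).
  rewrite big_pair /=.
  under eq_bigr do under eq_bigr do rewrite -mulrA.
  under eq_bigr do rewrite -mulr_sumr cond_lawS_sum.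
  rewrite cond_lawS_sum big_pair.
  apply: eq_bigr => a _; under [RHS]eq_bigr do rewrite big_pair.
  rewrite [RHS]exchange_big; apply: eq_bigr => b _ /=.
  rewrite [LHS]mulr_sumr; apply: eq_bigr => a' _ /=.
  rewrite [LHS]mulr_sumr; apply: eq_bigr => b' _.
  by ring.
under [RHS]eq_bigr do rewrite exchange_big/=.
rewrite [RHS]exchange_big; apply: eq_bigr => h _ /=.
transitivity (\sum_(g0 : innov n) \sum_(g1 : innov n) \sum_p \sum_r
   innov_weight g0 * (cond_law g0 p.1 * cond_law g0 p.2) *
   (innov_weight g1 * (cond_law g1 r.1 * cond_law g1 r.2)) *
   (nu h * V (h (p.1, r.1), h (p.2, r.2)))).
  rewrite mulr_sumr; apply: eq_bigr => g0 _; rewrite mulr_sumr; apply: eq_bigr => g1 _.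
  rewrite mulrA [LHS]mulr_sumr; apply: eq_bigr => p _.
  by rewrite [LHS]mulr_sumr; apply: eq_bigr => r _; ring.
under [LHS]eq_bigr do rewrite exchange_big/=.
rewrite [LHS]exchange_big/=; apply: eq_bigr => p _.
under [LHS]eq_bigr do rewrite exchange_big/=.
rewrite [LHS]exchange_big/=; apply: eq_bigr => r _.
under [LHS]eq_bigr do rewrite -mulr_suml.
by rewrite -mulr_suml mulr_sum2.
Qed.

(** Only the value at the first daughter changes. The weight w serves twice: as the indicator of the
    diagonal in the bound from below, as the constant 1 in the bound from above. *)
Lemma pairing_fst_step n (V : T * T -> R) (w : T -> T -> R) :
  \sum_p \sum_r \sum_(h : G) coupling n p * coupling n r *
    (w r.1 r.2 * (nu h * V (h (p.1, r.1), h (p.2, r.1)))) =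
  \sum_p coupling n p * \sum_b (\sum_b' coupling n (b, b') * w b b') *
    \sum_(h : G) nu h * V (h (p.1, b), h (p.2, b)).
Proof.
apply: eq_bigr => p _; rewrite [RHS]mulr_sumr big_pair; apply: eq_bigr => b _ /=.
rewrite [X in _ = _ * X]mulr_suml [RHS]mulr_sumr; apply: eq_bigr => b' _.
by rewrite mulrA [RHS]mulr_sumr; apply: eq_bigr => h _; ring.
Qed.

(** Exchanging the daughters reduces this to the first step, by the symmetry of [h], of [coupling]
    and of [w]. *)
Lemma pairing_snd_step n (V : T * T -> R) (w : T -> T -> R) :
  (forall a b, w a b = w b a) ->
  \sum_p \sum_r \sum_(h : G) coupling n p * coupling n r *
    (w p.1 p.2 * (nu h * V (h (p.2, r.1), h (p.2, r.2)))) =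
  \sum_p coupling n p * \sum_b (\sum_b' coupling n (b, b') * w b b') *
    \sum_(h : G) nu h * V (h (p.1, b), h (p.2, b)).
Proof.
move=> w_sym; rewrite exchange_big/= -pairing_fst_step.
apply: eq_bigr => p _; rewrite big_pair exchange_big [RHS]big_pair /=.
apply: eq_bigr => b _; apply: eq_bigr => b' _; apply: eq_bigr => h _ /=.
rewrite [coupling n (b', b)]coupling_sym [w b' b]w_sym.
have [->|hn0] := eqVneq (nu h) 0; first by rewrite !mul0r !mulr0.
by rewrite ![h (b, _)]nu_sym//; ring.
Qed.

(** If the copies agree at exactly one daughter, one of the two weighted terms equals V at the root
    and the other is 0; if they agree at both, everything vanishes; otherwise both terms are 0.
    Agreement at the value b has weight [coupling n (b, b)], at least c mu(b). *)
Lemma pairing_couplingS_ge n (V : T * T -> R) c :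
  (forall p, 0 <= V p) -> (forall x, V (x, x) = 0) ->
  (forall b, c * mu b <= coupling n (b, b)) ->
  2 * c * pairing (coupling n) (pair_op V) <= pairing (coupling n.+1) V.
Proof.
move=> V0 Vd cmu; pose w (a b : T) : R := (a == b)%:R.
have w_sym a b : w a b = w b a by rewrite /w eq_sym.
apply: (@le_trans _ _ (\sum_p \sum_r \sum_(h : G) coupling n p * coupling n r *
    (w r.1 r.2 * (nu h * V (h (p.1, r.1), h (p.2, r.1)))) +
  \sum_p \sum_r \sum_(h : G) coupling n p * coupling n r *
    (w p.1 p.2 * (nu h * V (h (p.2, r.1), h (p.2, r.2)))))).
  rewrite pairing_snd_step// pairing_fst_step -mulr2n -[leRHS]mulr_natl -mulrA.
  rewrite ler_wpM2l// [leLHS]mulr_sumr ler_sum// => p _.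
  rewrite mulrCA ler_wpM2l ?coupling_ge0// [leLHS]mulr_sumr ler_sum// => b _.
  rewrite mulrA ler_wpM2r//.
    by rewrite sumr_ge0// => h _; rewrite mulr_ge0.
  rewrite (bigD1 b)//= /w eqxx mulr1 big1 ?addr0// => b' /negbTE.
  by rewrite eq_sym => ->; rewrite mulr0.
rewrite pairing_couplingS -big_split ler_sum// => p _.
rewrite -big_split ler_sum// => r _; rewrite -big_split ler_sum// => h _ /=.
rewrite -mulrDr ler_wpM2l ?mulr_ge0 ?coupling_ge0//.
rewrite /w; case: eqP => [<-|_]; case: eqP => [<-|_]; rewrite ?Vd.
- by rewrite !mulr0 addr0.
- by rewrite mul1r mul0r addr0.
- by rewrite mul1r mul0r add0r.
- by rewrite !mul0r addr0 mulr_ge0.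
Qed.

Lemma pairing_couplingS_metric n (d : T * T -> R) a a' :
  (forall p, 0 <= d p) -> (forall x, d (x, x) = 0) ->
  (forall x y z, d (x, z) <= d (x, y) + d (y, z)) ->
  pairing (coupling n.+1) d +
    coupling n (a, a') ^+ 2 * (\sum_(h : G) nu h * d (h (a, a'), h (a', a'))) <=
  2 * pairing (coupling n) (pair_op d).
Proof.
move=> d0 dd dtri.
(* The path from h(p.1, r.1) to h(p.2, r.2) goes through h(p.2, r.1). Each half gives one term, once
   the other daughter is summed out by its marginal [mu]. *)
have -> : 2 * pairing (coupling n) (pair_op d) =
  \sum_p \sum_r \sum_(h : G) coupling n p * coupling n r *
    (1 * (nu h * d (h (p.1, r.1), h (p.2, r.1)))) +
  \sum_p \sum_r \sum_(h : G) coupling n p * coupling n r *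
    (1 * (nu h * d (h (p.2, r.1), h (p.2, r.2)))).
  rewrite (pairing_snd_step n d (w := fun _ _ => 1))//.
  rewrite (pairing_fst_step n d (fun _ _ => 1)) -mulr2n -[RHS]mulr_natl.
  congr (_ * _); apply: eq_bigr => p _; congr (_ * _); apply: eq_bigr => b _.
  by under [X in _ = X * _]eq_bigr do rewrite mulr1; rewrite coupling_marginal.
rewrite pairing_couplingS -big_split.
(* For p = (a, a') and r = (a', a) symmetry makes the direct distance 0, while the first half of the
   path still has length d(h(a, a'), h(a', a')). This excess has weight
   [coupling n (a, a') ^+ 2]. *)
pose gap (p r : T * T) (h : G) : R :=
  ((p == (a, a')) && (r == (a', a)))%:R * (nu h * d (h (a, a'), h (a', a'))).
have -> : coupling n (a, a') ^+ 2 * (\sum_(h : G) nu h * d (h (a, a'), h (a', a'))) =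
  \sum_p \sum_r \sum_(h : G) coupling n p * coupling n r * gap p r h.
  rewrite (bigD1 (a, a'))//= [X in _ = _ + X]big1 ?addr0; last first.
    move=> p /negbTE pn; rewrite big1// => r _; rewrite big1// => h _.
    by rewrite /gap pn mul0r mulr0.
  rewrite (bigD1 (a', a))//= [X in _ = _ + X]big1 ?addr0; last first.
    by move=> r /negbTE rn; rewrite big1// => h _; rewrite /gap rn andbF mul0r mulr0.
  rewrite [coupling n (a', a)]coupling_sym -expr2 -mulr_sumr; congr (_ * _).
  by apply: eq_bigr => h _; rewrite /gap !eqxx mul1r.
rewrite -big_split ler_sum// => p _; rewrite -!big_split ler_sum// => r _.
rewrite -!big_split ler_sum// => h _ /=.
rewrite -!mulrDr ler_wpM2l ?mulr_ge0 ?coupling_ge0// /gap.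
have [->|hn0] := eqVneq (nu h) 0; first by rewrite !mul0r !mulr0 addr0.
case: (eqVneq p (a, a')) => [->|_]; case: (eqVneq r (a', a)) => [->|_] /=;
  rewrite ?mul0r ?addr0 ?mul1r -?mulrDr ler_wpM2l//.
by rewrite [h (a', a)]nu_sym// dd add0r lerDl.
Qed.

(** * Pseudometrics and superharmonic functions *)

Definition pseudometric (d : T * T -> R) : Prop :=
  [/\ forall p, 0 <= d p, forall x, d (x, x) = 0 &
      forall x y z, d (x, z) <= d (x, y) + d (y, z)].

Lemma pair_op_ge0 (V : T * T -> R) :
  (forall p, 0 <= V p) -> forall p, 0 <= pair_op V p.
Proof.
move=> V0 p; rewrite sumr_ge0// => b _; rewrite mulr_ge0 ?sumr_ge0 ?(ltW (mu_gt0 _))//.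
by move=> h _; rewrite mulr_ge0.
Qed.

Lemma pair_op_diag (V : T * T -> R) :
  (forall x, V (x, x) = 0) -> forall x, pair_op V (x, x) = 0.
Proof.
move=> Vd x; rewrite /pair_op big1// => b _; rewrite big1 ?mulr0// => h _.
by rewrite Vd mulr0.
Qed.

Lemma pair_op_le (V W : T * T -> R) :
  (forall p, V p <= W p) -> forall p, pair_op V p <= pair_op W p.
Proof.
move=> VW p; rewrite ler_sum// => b _; rewrite ler_wpM2l ?(ltW (mu_gt0 _))//.
by rewrite ler_sum// => h _; rewrite ler_wpM2l.
Qed.

(** [pair_op d] is an average of the pulled-back distances d(h(x, b), h(y, b)). *)
Lemma pair_op_pseudometric (d : T * T -> R) :
  pseudometric d -> pseudometric (pair_op d).
Proof.
move=> [d0 dd dtri]; split=> [p|x|x y z]; [exact: pair_op_ge0|exact: pair_op_diag|].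
rewrite /pair_op -big_split ler_sum// => b _ /=; rewrite -mulrDr ler_wpM2l ?(ltW (mu_gt0 _))//.
by rewrite -big_split ler_sum// => h _ /=; rewrite -mulrDr ler_wpM2l.
Qed.

(* The largest pseudometric d below V: since pair_op maps pseudometrics to
   pseudometrics, th^-1 * pair_op d is again a pseudometric below V. *)
Lemma superharmonic_pseudometric (V : T * T -> R) (th : R) :
  0 < th -> (forall x, V (x, x) = 0) -> (forall p, p.1 != p.2 -> 0 < V p) ->
  (forall p, p.1 != p.2 -> pair_op V p <= th * V p) ->
  exists d, [/\ pseudometric d, forall p, p.1 != p.2 -> 0 < d p &
    forall p, pair_op d p <= th * d p].
Proof.
move=> th0 Vd Vpos VP.
pose M := [set r | pseudometric r /\ forall p, r p <= V p].
have V0 p : 0 <= V p.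
  by case: p => x y; have [->|xy] := eqVneq x y; rewrite ?Vd// ltW// Vpos.
have M0 : M (fun=> 0) by split=> //; split=> // *; rewrite addr0.
pose d p := sup [set r p | r in M].
have rd r p : M r -> r p <= d p.
  move=> Mr; apply: ub_le_sup; last by exists r.
  by exists (V p) => _ [r' [_ r'V]] <-.
have dle p c : (forall r, M r -> r p <= c) -> d p <= c.
  move=> rc; apply: ge_sup; first by exists 0, (fun=> 0).
  by move=> _ [r Mr] <-; exact: rc.
have dV p : d p <= V p by apply: dle => r [_].
have d0 p : 0 <= d p := rd _ p M0.
have dd x : d (x, x) = 0 by apply/eqP; rewrite eq_le d0 -{1}(Vd x) dV.
have dtri x y z : d (x, z) <= d (x, y) + d (y, z).
  apply: dle => r Mr; have [[_ _ rtri] _] := Mr.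
  by rewrite (le_trans (rtri x y z))// lerD// rd.
have dpm : pseudometric d by [].
exists d; split=> // p.
  move=> pn.
  (* Positivity comes from comparison with e times the discrete metric, which lies below V. The
     value 1 on the diagonal only keeps the function positive there. *)
  have [e e0 eV] : exists2 e, 0 < e & forall q, e <= (if q.1 != q.2 then V q else 1).
    by apply: finite_pos_lbound => q; case: ifPn => // /Vpos.
  apply: (@lt_le_trans _ _ (e * (p.1 != p.2)%:R)); first by rewrite pn mulr1.
  apply: (rd (fun q => e * (q.1 != q.2)%:R)); split.
    split=> [q|x|x y z] /=; rewrite ?eqxx ?mulr0 ?mulr_ge0// ?(ltW e0)//.
    rewrite -mulrDr ler_wpM2l ?(ltW e0)// -natrD ler_nat.
    have [->|_] := eqVneq x y; first by rewrite leq_addl.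
    exact: leq_trans (leq_b1 _) (leq_addr _ _).
  move=> q /=; have := eV q; case: ifPn => [_|_]; rewrite ?mulr1// mulr0.
  by move=> _; exact: V0.
rewrite -ler_pdivrMl//; apply: (rd (fun q => th^-1 * pair_op d q)); split.
  have [P0 Pd Ptri] := pair_op_pseudometric dpm.
  split=> [q|x|x y z]; first by rewrite mulr_ge0// invr_ge0 ltW.
    by rewrite Pd mulr0.
  by rewrite -mulrDr ler_wpM2l// invr_ge0 ltW.
case=> x y; rewrite ler_pdivrMl//; have [<-|xy] := eqVneq x y.
  by rewrite Vd mulr0 pair_op_diag.
exact: le_trans (pair_op_le dV _) (VP (x, y) xy).
Qed.

(** * Off-diagonal mass in the three regimes *)

Definition off_mass n : R := \sum_(p | p.1 != p.2) coupling n p.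

Lemma off_massE n : off_mass n = \sum_x (mu x - coupling n (x, x)).
Proof.
rewrite /off_mass big_mkcond big_pair; apply: eq_bigr => x _ /=.
rewrite -(coupling_marginal n) (bigD1 x)//= eqxx add0r.
rewrite [X in _ = X - _](bigD1 x)//= addrAC subrr add0r.
by apply: eq_bigr => y; rewrite eq_sym => ->.
Qed.

Lemma off_mass_le_pairing (d : T * T -> R) :
  (forall p, 0 <= d p) -> (forall p, p.1 != p.2 -> 0 < d p) ->
  exists2 e, 0 < e & forall n, e * off_mass n <= pairing (coupling n) d.
Proof.
move=> d0 dpos.
have [e e0 ed] : exists2 e, 0 < e & forall q, e <= (if q.1 != q.2 then d q else 1).
  by apply: finite_pos_lbound => q; case: ifPn => // /dpos.
exists e => // n; rewrite /off_mass mulr_sumr big_mkcond ler_sum// => p _.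
have := ed p; case: ifPn => _ => [edp|_]; last by rewrite mulr_ge0// coupling_ge0.
by rewrite mulrC ler_wpM2l// coupling_ge0.
Qed.

(** If e stayed above eta, it would lose delta every K steps and become negative. *)
Lemma descent_inf0 (e : nat -> R) : (forall n, 0 <= e n) ->
  (forall eta, 0 < eta -> exists2 delta, 0 < delta & exists K, forall n,
    eta < e n -> e (n + K)%N <= e n - delta) ->
  forall eta, 0 < eta -> exists n, e n <= eta.
Proof.
move=> e0 desc eta eta0; have [delta delta0 [K eK]] := desc _ eta0.
apply: contrapT => /forallNP ne.
have gt n : eta < e n by rewrite ltNge; apply/negP/ne.
have er r : e (r * K)%N <= e 0%N - delta * r%:R.
  elim: r => [|r IH]; first by rewrite mul0n mulr0 subr0.
  rewrite mulSn addnC (le_trans (eK _ (gt _)))// -natr1 mulrDr mulr1.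
  by rewrite opprD addrA lerD2r.
have := er (Num.trunc (e 0%N / delta)).+1; apply/negP; rewrite -ltNge.
apply: lt_le_trans (e0 _); rewrite subr_lt0 mulrC -ltr_pdivrMr//.
exact: Num.Theory.truncnS_gt.
Qed.

Lemma subcritical_off_mass (V : T * T -> R) (th : R) :
  0 < th -> 2 * th < 1 ->
  (forall x, V (x, x) = 0) -> (forall p, p.1 != p.2 -> 0 < V p) ->
  (forall p, p.1 != p.2 -> pair_op V p <= th * V p) ->
  forall eta, 0 < eta -> exists n, off_mass n <= eta.
Proof.
move=> th0 th1 Vd Vpos VP eta eta0.
have [d [[d0 dd dtri] dpos dP]] := superharmonic_pseudometric th0 Vd Vpos VP.
have [e e0 eoff] := off_mass_le_pairing d0 dpos.
have [n en] : exists n, pairing (coupling n) d <= e * eta; last first.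
  by exists n; rewrite -(ler_pM2l e0) (le_trans (eoff n)).
apply: descent_inf0 => [n|eta' eta'0|]; last exact: mulr_gt0.
- by rewrite sumr_ge0// => p _; rewrite mulr_ge0 ?coupling_ge0.
(* One step multiplies the pairing by at most 2 th, so above eta' it loses at least this amount. *)
- exists ((1 - 2 * th) * eta'); first by rewrite mulr_gt0// subr_gt0.
  exists 1%N => n en; rewrite addn1.
  (* The metric estimate is taken at a pair (a, a), where its gap term is merely nonnegative.
     Without any state the pairing is an empty sum and cannot exceed eta'. *)
  have [a _|nT] := pickP (@predT T); last first.
    by move: en; rewrite /pairing big1 ?ltNge ?(ltW eta'0)// => -[x]; have := nT x.
  have := pairing_couplingS_metric n a a d0 dd dtri.
  have : 0 <= coupling n (a, a) ^+ 2 * (\sum_(h : G) nu h * d (h (a, a), h (a, a))).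
    by rewrite mulr_ge0 ?sqr_ge0// sumr_ge0// => h _; rewrite mulr_ge0.
  have : pairing (coupling n) (pair_op d) <= th * pairing (coupling n) d.
    rewrite [leRHS]mulr_sumr ler_sum// => p _.
    by rewrite mulrCA ler_wpM2l// coupling_ge0.
  set E := pairing _ d in en *; set E1 := pairing (coupling n.+1) d; nra.
Qed.

Lemma mu_lbound : exists2 c, 0 < c & forall n b, c * mu b <= coupling n (b, b).
Proof.
have [c c0 cmu] := finite_pos_lbound mu_gt0; exists c => // n b.
by rewrite (le_trans _ (coupling_diag_ge n b))// expr2 ler_wpM2r// ltW.
Qed.

(** With V the indicator of a pair, this says that mass at any pair from which it is accessible
    reaches it k steps later, up to a constant factor. *)
Lemma pairing_couplingD_ge c (V : T * T -> R) n k : 0 < c ->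
  (forall n b, c * mu b <= coupling n (b, b)) ->
  (forall p, 0 <= V p) -> (forall x, V (x, x) = 0) ->
  (2 * c) ^+ k * pairing (coupling n) (iter k pair_op V) <=
  pairing (coupling (n + k)) V.
Proof.
move=> c0 cmu V0 Vd.
have iterV l : (forall p, 0 <= iter l pair_op V p) /\ (forall x, iter l pair_op V (x, x) = 0).
  by elim: l => //= l [IH0 IHd]; split; [exact: pair_op_ge0 | exact: pair_op_diag].
elim: k n => [|k IH] n; first by rewrite addn0 expr0 mul1r.
rewrite -addSnnS (le_trans _ (IH _))// exprSr -mulrA ler_wpM2l ?exprn_ge0 ?mulr_ge0 ?(ltW c0)//.
by have [? ?] := iterV k; exact: pairing_couplingS_ge.
Qed.

Lemma critical_off_mass (V : T * T -> R) a a' :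
  (forall x, V (x, x) = 0) -> (forall p, p.1 != p.2 -> 0 < V p) ->
  (forall p, p.1 != p.2 -> pair_op V p <= 2^-1 * V p) ->
  a != a' ->
  0 < \sum_(h : G) nu h * (h (a, a') != h (a', a'))%:R ->
  (forall p, p.1 != p.2 ->
    exists k, 0 < iter k pair_op (fun q => (q == (a, a'))%:R) p) ->
  forall eta, 0 < eta -> exists n, off_mass n <= eta.
Proof.
move=> Vd Vpos VP aa' nu_a irr eta eta0.
have [|d [[d0 dd dtri] dpos dP]] := superharmonic_pseudometric _ Vd Vpos VP.
  by rewrite invr_gt0.
have [e e0 eoff] := off_mass_le_pairing d0 dpos.
pose E n := pairing (coupling n) d.
have E0 n : 0 <= E n by rewrite sumr_ge0// => p _; rewrite mulr_ge0 ?coupling_ge0.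
pose kap := \sum_(h : G) nu h * d (h (a, a'), h (a', a')).
have kap0 : 0 < kap.
  have k0 h : 0 <= nu h * d (h (a, a'), h (a', a')) by rewrite mulr_ge0.
  rewrite lt_neqAle sumr_ge0 ?andbT//; apply: contraTneq nu_a => /esym/eqP.
  rewrite psumr_eq0// => /allP kE; rewrite big1 ?ltxx// => h _.
  have := kE h (mem_index_enum h) => /=; rewrite mulf_eq0 => /orP[/eqP ->|].
    by rewrite mul0r.
  have [_|/(dpos (_, _)) dn] := eqVneq (h (a, a')) (h (a', a')); first by rewrite mulr0.
  by rewrite gt_eqF.
(* With 2 th = 1 the metric estimate bounds the gap term by the decrease of E. *)
have gap n : coupling n (a, a') ^+ 2 * kap <= E n - E n.+1.
  have := pairing_couplingS_metric n a a' d0 dd dtri.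
  have : pairing (coupling n) (pair_op d) <= 2^-1 * E n.
    rewrite [leRHS]mulr_sumr ler_sum// => p _.
    by rewrite mulrCA ler_wpM2l// coupling_ge0.
  rewrite -/kap -/(E _); lra.
have EnS n : E n.+1 <= E n.
  by rewrite -subr_ge0 (le_trans _ (gap n))// mulr_ge0 ?sqr_ge0// ltW.
have Emono n k : E (n + k)%N <= E n.
  by elim: k => [|k IH]; rewrite ?addn0// addnS (le_trans (EnS _)).
have [c c0 cmu] := mu_lbound.
pose U (q : T * T) : R := (q == (a, a'))%:R.
have [k kP] : exists k : T * T -> nat, forall p, p.1 != p.2 -> 0 < iter (k p) pair_op U p.
  have /choice[k kP] : forall p : T * T, exists l, p.1 != p.2 -> 0 < iter l pair_op U p.
    move=> p; have [pd|pn] := boolP (p.1 == p.2); first by exists 0%N.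
    by have [l lP] := irr _ pn; exists l.
  by exists k.
pose al p := (2 * c) ^+ k p * iter (k p) pair_op U p.
have al0 p : p.1 != p.2 -> 0 < al p.
  by move=> pn; rewrite mulr_gt0 ?kP// exprn_gt0// mulr_gt0.
have reach n p : p.1 != p.2 -> al p * coupling n p <= coupling (n + k p) (a, a').
  move=> pn; have U0 q : 0 <= U q by [].
  have Ud x : U (x, x) = 0.
    rewrite /U; case: eqP => // -[xa xa']; by rewrite -xa -xa' eqxx in aa'.
  have -> : coupling (n + k p) (a, a') = pairing (coupling (n + k p)) U.
    rewrite /pairing (bigD1 (a, a'))//= /U eqxx mulr1 big1 ?addr0// => q /negbTE ->.
    by rewrite mulr0.
  apply: le_trans (pairing_couplingD_ge n (k p) c0 cmu U0 Ud).
  rewrite -mulrA ler_wpM2l ?exprn_ge0 ?mulr_ge0 ?(ltW c0)//.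
  rewrite /pairing (bigD1 p)//= mulrC lerDl sumr_ge0// => q _.
  rewrite mulr_ge0 ?coupling_ge0//; elim: (k p) q => //= l IH q.
  exact: pair_op_ge0.
(* The successor leaves room, for all p at once, for the step from n + k p to n + k p + 1 in which
   the gap is used. *)
pose K := (\sum_p k p).+1.
pose D := \sum_p d p / al p.
have D0 : 0 <= D.
  rewrite sumr_ge0// => -[x y] _; have [<-|xy] := eqVneq x y; first by rewrite dd mul0r.
  by rewrite mulr_ge0// invr_ge0 ltW// al0.
(* [coupling n p] is at most [coupling (n + k p) (a, a')] divided by [al p], and the square of this
   numerator is at most 1/kap times a decrease of E within the window from n to n + K. *)
have EK n : E n <= D * Num.sqrt ((E n - E (n + K)%N) / kap).
  rewrite mulr_suml ler_sum// => -[x y] _.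
  have [<-|xy] := eqVneq x y; first by rewrite dd mulr0 !mul0r.
  have al_xy := al0 (x, y) xy.
  rewrite mulrC -mulrA ler_wpM2l// ler_pdivlMl//.
  rewrite (le_trans (reach n (x, y) xy))// -[leLHS]ger0_norm ?coupling_ge0//.
  rewrite -sqrtr_sqr ler_wsqrtr// ler_pdivlMr// (le_trans (gap _))// lerB//.
  have kK : (k (x, y) <= \sum_p k p)%N by rewrite (bigD1 (x, y))//= leq_addr.
  have -> : (n + K = (n + k (x, y)).+1 + (\sum_p k p - k (x, y)))%N.
    by rewrite /K addSn -addnA subnKC// addnS.
  exact: Emono.
have [n en] : exists n, E n <= e * eta; last first.
  by exists n; rewrite -(ler_pM2l e0) (le_trans (eoff n)).
apply: (descent_inf0 E0) => [eta' eta'0|]; last exact: mulr_gt0.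
(* The previous estimate is solved for the decrease of E; D + 1 replaces D, which may be 0. *)
- exists (kap * (eta' / (D + 1)) ^+ 2).
    by rewrite mulr_gt0// exprn_gt0// divr_gt0// ltr_wpDl.
  exists K => n en.
  have Delta0 : 0 <= (E n - E (n + K)%N) / kap.
    by rewrite mulr_ge0 ?subr_ge0 ?Emono// invr_ge0 ltW.
  have s_ge : eta' / (D + 1) <= Num.sqrt ((E n - E (n + K)%N) / kap).
    rewrite ler_pdivrMr ?ltr_wpDl// mulrDr mulr1 mulrC.
    by rewrite (le_trans (ltW en))// (le_trans (EK n))// lerDl sqrtr_ge0.
  rewrite lerBrDr -lerBrDl -ler_pdivlMl// [leRHS]mulrC -[leRHS]sqr_sqrtr//.
  have q0 : 0 <= eta' / (D + 1) by rewrite divr_ge0 ?(ltW eta'0)// addr_ge0.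
  by rewrite lerXn2r// ?nnegrE ?sqrtr_ge0.
Qed.

Lemma supercritical_coupling (V : T * T -> R) (rho : R) p0 :
  1 < 2 * rho -> (forall p, 0 <= V p) -> (forall x, V (x, x) = 0) -> 0 < V p0 ->
  (forall p, rho * V p <= pair_op V p) ->
  ~ (forall eta, 0 < eta -> exists n0, forall n, (n0 <= n)%N ->
      forall x, mu x - coupling n (x, x) <= eta).
Proof.
move=> rho1 V0 Vd Vp0 VP lim0.
have rho0 : 0 < rho by lra.
pose E n := pairing (coupling n) V.
have PE n : rho * E n <= pairing (coupling n) (pair_op V).
  by rewrite [leLHS]mulr_sumr ler_sum// => p _; rewrite mulrCA ler_wpM2l// coupling_ge0.
have [c c0 cmu] := mu_lbound.
(* Positivity at all times uses the crude constant of [mu_lbound]; the constant c1 below is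
   available only from time n0 on. *)
have Epos k : 0 < E k.
  elim: k => [|n IH].
    rewrite /E /pairing (bigD1 p0)//=; apply: ltr_pwDl.
      by rewrite coupling0 !mulr_gt0.
    by rewrite sumr_ge0// => p _; rewrite mulr_ge0 ?coupling_ge0.
  apply: lt_le_trans (pairing_couplingS_ge V0 Vd (cmu n)).
  rewrite !mulr_gt0//; apply: lt_le_trans (PE n); exact: mulr_gt0.
have [m m0 mmu] := finite_pos_lbound mu_gt0.
(* At this value 2 c1 rho = 1. A defect of at most (1 - c1) m, with m a lower bound of [mu], leaves
   [coupling n (b, b)] at least c1 mu(b). *)
pose c1 := (2 * rho)^-1.
have c1lt1 : c1 < 1 by rewrite invf_lt1// mulr_gt0.
have [|n0 n0P] := lim0 ((1 - c1) * m); first by rewrite mulr_gt0// subr_gt0.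
have ES n : (n0 <= n)%N -> E n <= E n.+1.
  move=> n0n; have c1mu b : c1 * mu b <= coupling n (b, b).
    have := n0P n n0n b; have := mmu b; nra.
  apply: le_trans (pairing_couplingS_ge V0 Vd c1mu).
  apply: (@le_trans _ _ (2 * c1 * (rho * E n))).
    rewrite (_ : _ * (rho * _) = E n)//.
    by rewrite mulrA [2 * c1]mulrC -[c1 * _ * _]mulrA mulVf ?mul1r// mulf_neq0// gt_eqF.
  by rewrite ler_wpM2l// mulr_ge0// invr_ge0 mulr_ge0// ltW.
have Emono n : (n0 <= n)%N -> E n0 <= E n.
  by elim: n => [|n IH]; [rewrite leqn0 => /eqP -> | rewrite leq_eqVlt ltnS => /orP[/eqP ->//|/[dup] /ES] /[swap] /IH; exact: le_trans].
pose M := \sum_p V p.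
have M0 : 0 < M by rewrite /M (bigD1 p0)//= ltr_pwDl// sumr_ge0.
have EM n : E n <= M * off_mass n.
  rewrite /off_mass mulr_sumr [leRHS]big_mkcond ler_sum// => -[x y] _ /=.
  have [<-|xy] := eqVneq x y; first by rewrite Vd mulr0.
  rewrite mulrC ler_wpM2r ?coupling_ge0// /M (bigD1 (x, y))//= lerDl sumr_ge0//.
(* N exceeds the number of states, so defects of at most E n0 / (M N) sum to less than E n0 / M. *)
pose N : R := 1 + \sum_(x : T) 1.
have N0 : 0 < N by rewrite ltr_pwDl// sumr_ge0.
have [|n1 n1P] := lim0 (E n0 / (M * N)); first by rewrite divr_gt0// mulr_gt0.
have n0n : (n0 <= maxn n0 n1)%N := leq_maxl _ _.
have := Emono _ n0n; apply/negP; rewrite -ltNge.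
apply: (le_lt_trans (EM _)); rewrite -ltr_pdivlMl// off_massE.
apply: (@le_lt_trans _ _ (\sum_(x : T) 1 * (E n0 / (M * N)))).
  by rewrite ler_sum// => x _; rewrite mul1r n1P// leq_maxr.
rewrite -mulr_suml (_ : _ * _ = M^-1 * E n0 * ((\sum_(x : T) 1) / N)); last first.
  by rewrite invfM; ring.
by rewrite -[ltRHS]mulr1 ltr_pM2l ?mulr_gt0 ?invr_gt0// ltr_pdivrMr// mul1r ltrDr.
Qed.

End recursive_coupling.

(** * Finite-dimensional laws *)

Lemma finite_preimage_measurable (d : measure_display) (X : measurableType d)
    (I : finType) (f : X -> I) (Q : set I) :
  (forall i, measurable [set x | f x = i]) -> measurable [set x | Q (f x)].
Proof.
move=> mf; rewrite (_ : mkset _ = \bigcup_(i in Q) [set x | f x = i]).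
  by apply: fin_bigcup_measurable => //; exact: finite_finset.
by apply/seteqP; split=> [x Qx|x [i Qi /= ->]//]; exists (f x).
Qed.

Lemma fine_measureU (R : realType) (d : measure_display) (X : measurableType d)
    (P : probability X R) (A B : set X) :
  measurable A -> measurable B -> A `&` B = set0 ->
  fine (P (A `|` B)) = fine (P A) + fine (P B).
Proof. by move=> mA mB AB; rewrite measureU// fineD ?fin_num_measure. Qed.

Lemma fine_measure_fiber (R : realType) (d : measure_display)
    (X : measurableType d) (P : probability X R) (I : finType) (f : X -> I)
    (B : set X) (Q : pred I) :
  measurable B -> (forall i, measurable [set x | f x = i]) ->
  fine (P (B `&` [set x | Q (f x)])) =
  \sum_(i | Q i) fine (P (B `&` [set x | f x = i])).
Proof.
move=> mB mf.
have Ps s : uniq s -> fine (P (B `&` [set x | f x \in s])) =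
    \sum_(i <- s) fine (P (B `&` [set x | f x = i])).
  elim: s => [_|i s IH /= /andP[ins us]].
    rewrite big_nil (_ : _ `&` _ = set0) ?measure0//.
    by apply/seteqP; split=> // x [].
  rewrite big_cons -IH// -fine_measureU.
  - congr (fine (P _)); rewrite -setIUr; congr (_ `&` _).
    apply/seteqP; split=> x /=; rewrite in_cons; first by move=> /orP[/eqP|]; [left|right].
    by move=> [->|->]; rewrite ?eqxx// orbT.
  - exact: measurableI.
  - by apply: measurableI => //; exact: (@finite_preimage_measurable _ _ _ f [set j | j \in s]).
  - apply/seteqP; split=> // x [[_ /= ->] [_]].
    by rewrite (negbTE ins).
rewrite -big_enum -Ps ?enum_uniq//; congr (fine (P (_ `&` _))).
by apply/seteqP; split=> x /=; rewrite mem_enum.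
Qed.

Lemma fine_measure_finite (R : realType) (d : measure_display)
    (X : measurableType d) (P : probability X R) (I : finType) (f : X -> I)
    (Q : pred I) :
  (forall i, measurable [set x | f x = i]) ->
  fine (P [set x | Q (f x)]) = \sum_(i | Q i) fine (P [set x | f x = i]).
Proof.
move=> mf; rewrite -[X in P X]setTI fine_measure_fiber//.
by apply: eq_bigr => i _; rewrite setTI.
Qed.

(** The first letter of a word selects one of the two subtrees at the root. *)
Lemma big_tuple_boolS (R : comNzRingType) (n : nat) (F : seq bool -> R) :
  \prod_(u : n.+1.-tuple bool) F u =
  (\prod_(u : n.-tuple bool) F (false :: u)) *
  (\prod_(u : n.-tuple bool) F (true :: u)).
Proof.
rewrite (reindex (fun p : bool * n.-tuple bool => [tuple of p.1 :: p.2])) /=.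
  rewrite -(pair_bigA _ (fun (b : bool) (u : n.-tuple bool) => F (b :: u))) /=.
  by rewrite big_bool mulrC.
exists (fun u => (thead u, [tuple of behead u])) => [[b u] _|u _] /=.
  by congr pair; apply: val_inj.
by rewrite [RHS]tuple_eta; apply: val_inj.
Qed.

Lemma big_tuple_bool0 (R : comNzRingType) (F : seq bool -> R) :
  \prod_(u : 0.-tuple bool) F u = F [::].
Proof.
rewrite (bigD1 [tuple])//= big1 ?mulr1// => u.
by move=> /eqP[]; exact: tuple0.
Qed.

Section rtp_law.
Context (R : realType) (dS dE : measure_display).
Context (S : finMeasurableType dS) (E : measurableType dE) (D : rtp R S E).
Notation G := {ffun S * S -> S}.

Definition state_mass (x : S) : R := fine (rtp_mu D [set x]).

Definition innov_map (z : E) : G := [ffun p => rtp_phi D p.1 p.2 z].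

Definition innov_mass (h : G) : R := fine (rtp_nu D [set z | innov_map z = h]).

Lemma measurable_phi_slice a b x : measurable [set z | rtp_phi D a b z = x].
Proof.
have mp : measurable_fun setT (fun z : E => ((a, b), z) : S * S * E).
  by apply: measurable_fun_pair => //; exact: measurable_id.
have := measurableT_comp (rtp_phi_measurable D) mp.
move=> /(_ measurableT [set x] (discrete_measurableP [set x])).
by rewrite setTI.
Qed.

Lemma measurable_innov_map h : measurable [set z | innov_map z = h].
Proof.
rewrite (_ : mkset _ = \bigcap_(p in [set: S * S]) [set z | rtp_phi D p.1 p.2 z = h p]).
  apply: fin_bigcap_measurable; first exact: finite_finset.
  by move=> p _; exact: measurable_phi_slice.
apply/seteqP; split=> [z <- p _ /=|z zh]; first by rewrite ffunE.
by apply/ffunP => p; rewrite ffunE; exact: zh.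
Qed.

Lemma state_mass_gt0 x : 0 < state_mass x.
Proof. by rewrite fine_gt0// rtp_mu_gt0 ltey_eq fin_num_measure//; exact: discrete_measurableP. Qed.

Lemma state_mass_sum1 : \sum_x state_mass x = 1.
Proof.
have := @fine_measure_finite _ _ _ (rtp_mu D) _ id xpredT (fun=> discrete_measurableP _).
by rewrite [X in rtp_mu D X](_ : _ = setT) ?probability_setT/= => [<-|]; last by apply/seteqP; split.
Qed.

Lemma innov_mass_ge0 h : 0 <= innov_mass h.
Proof. by rewrite fine_ge0. Qed.

Lemma innov_mass_sum1 : \sum_h innov_mass h = 1.
Proof.
have := @fine_measure_finite _ _ _ (rtp_nu D) _ innov_map xpredT measurable_innov_map.
by rewrite [X in rtp_nu D X](_ : _ = setT) ?probability_setT/= => [<-|]; last by apply/seteqP; split.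
Qed.

(** A map of nonzero mass is [innov_map z] for some z, and inherits the symmetry of [rtp_phi]. *)
Lemma innov_mass_sym h : innov_mass h != 0 -> forall a b, h (a, b) = h (b, a).
Proof.
move=> hn0 a b; have [z <-] : exists z, innov_map z = h.
  apply: contrapT => /forallNP nz; move/eqP: hn0; apply; rewrite /innov_mass (_ : mkset _ = set0) ?measure0//.
  by apply/seteqP; split=> // z /nz.
by rewrite !ffunE /= rtp_phi_sym.
Qed.

Lemma P2_pair_op (V : S * S -> R) p :
  \sum_q P2 D p q * V q = pair_op state_mass innov_mass V p.
Proof.
transitivity (\sum_q \sum_b \sum_(h : G) state_mass b * (innov_mass h * (((h (p.1, b), h (p.2, b)) == q)%:R * V q))).
  apply: eq_bigr => q _; rewrite mulr_suml; apply: eq_bigr => b _.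
  rewrite -/(state_mass b) -mulrA -mulr_sumr; congr (_ * _).
  have := @fine_measure_finite _ _ _ (rtp_nu D) _ innov_map
    (fun h => (h (p.1, b), h (p.2, b)) == q) measurable_innov_map.
  rewrite (_ : mkset _ = [set z | rtp_phi D p.1 b z = q.1 /\ rtp_phi D p.2 b z = q.2]).
    move=> ->; rewrite mulr_suml big_mkcond; apply: eq_bigr => h _ /=.
    by case: ifP => _; rewrite ?mul1r// !mul0r mulr0.
  apply/seteqP; split=> z /=; rewrite !ffunE/=; first by case: q => q1 q2 /eqP[-> ->].
  by move=> [-> ->]; case: q.
rewrite exchange_big; apply: eq_bigr => b _ /=.
rewrite exchange_big mulr_sumr; apply: eq_bigr => h _ /=.
rewrite -mulr_sumr; congr (_ * _); rewrite -mulr_sumr; congr (_ * _).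
rewrite (bigD1 (h (p.1, b), h (p.2, b)))//= eqxx mul1r big1 ?addr0// => q.
by rewrite eq_sym => /negbTE ->; rewrite mul0r.
Qed.

(** * Truncated trees inside a configuration and their law *)

Fixpoint innov_at n (v : seq bool) (w : Omega D) : innov S n :=
  match n with
  | 0 => tt
  | k.+1 => (innov_map (eps w v),
      (innov_at k (rcons v false) w, innov_at k (rcons v true) w))
  end.

Fixpoint leaves_at n (v : seq bool) (w : Omega D) : leaves S n :=
  match n with
  | 0 => xi w v
  | k.+1 => (leaves_at k (rcons v false) w, leaves_at k (rcons v true) w)
  end.

Lemma root_val_at n v w : root_val (innov_at n v w) (leaves_at n v w) = xi w v.
Proof. by elim: n v => //= n IH v; rewrite !IH ffunE /= -OmegaP. Qed.

(** [leaf_set] and [innov_set] write the events that the leaves are [s] and the innovations are [g]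
    as rectangles indexed by words, the form in which [is_rtp_law] gives the law. The words that
    matter have length n for leaves and less than n for innovations. *)
Fixpoint leaf_set n : leaves S n -> seq bool -> set S :=
  match n with
  | 0 => fun s _ => [set s]
  | k.+1 => fun (s : leaves S k.+1) u =>
      if u is b :: u' then leaf_set (if b then s.2 else s.1) u' else setT
  end.

Fixpoint innov_set n : innov S n -> seq bool -> set E :=
  match n with
  | 0 => fun _ _ => setT
  | k.+1 => fun (g : innov S k.+1) u =>
      if u is b :: u' then innov_set (if b then g.2.2 else g.2.1) u'
      else [set z | innov_map z = g.1]
  end.

Lemma measurable_innov_set n (g : innov S n) u : measurable (innov_set g u).
Proof.
by elim: n g u => [|n IH] g [|b u] //=; exact: measurable_innov_map.
Qed.

Lemma leaves_atP n v w s :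
  leaves_at n v w = s <-> forall u, size u = n -> leaf_set s u (xi w (v ++ u)).
Proof.
elim: n v s => [|n IH] v s /=.
  split=> [<- u /size0nil ->|/(_ [::] erefl)]; by rewrite cats0.
case: s => s0 s1; split=> [[<- <-] [|b u]//= [] su|sP].
  by rewrite -cat_rcons; case: b; apply: (IH _ _).1.
congr (_, _).
- by apply/IH => u su; rewrite cat_rcons; apply: (sP (false :: u)); rewrite /= su.
- by apply/IH => u su; rewrite cat_rcons; apply: (sP (true :: u)); rewrite /= su.
Qed.

Lemma innov_atP n v w g :
  innov_at n v w = g <-> forall u, (size u < n)%N -> innov_set g u (eps w (v ++ u)).
Proof.
elim: n v g => [|n IH] v g /=; first by split=> // _; case: g.
case: g => h [g0 g1]; split=> [[<- <- <-] [|b u]//= su|gP].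
- by rewrite cats0.
- by rewrite -cat_rcons; case: b; apply: (IH _ _).1.
congr (_, (_, _)); first by have := gP [::] isT; rewrite cats0.
- by apply/IH => u su; rewrite cat_rcons; apply: (gP (false :: u)).
- by apply/IH => u su; rewrite cat_rcons; apply: (gP (true :: u)).
Qed.

Lemma prod_leaf_set n (s : leaves S n) :
  \prod_(u : n.-tuple bool) fine (rtp_mu D (leaf_set s u)) = leaves_weight state_mass s.
Proof.
elim: n s => [|n IH] s.
  by rewrite (big_tuple_bool0 (fun u => fine (rtp_mu D (leaf_set s u)))).
by rewrite (big_tuple_boolS n (fun u => fine (rtp_mu D (leaf_set s u)))) /= !IH.
Qed.

Lemma prod_innov_set n (g : innov S n) :
  \prod_(k < n) \prod_(u : k.-tuple bool) fine (rtp_nu D (innov_set g u)) =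
  innov_weight innov_mass g.
Proof.
elim: n g => [|n IH] g; first by rewrite big_ord0.
rewrite big_ord_recl (big_tuple_bool0 (fun u => fine (rtp_nu D (innov_set g u)))) /=.
congr (_ * _); rewrite -!IH -big_split/=; apply: eq_bigr => k _.
by rewrite (big_tuple_boolS k (fun u => fine (rtp_nu D (innov_set g u)))) /=.
Qed.

Lemma prod_fine (I : finType) (d : measure_display) (X : measurableType d)
    (P : probability X R) (A : I -> set X) : (forall i, measurable (A i)) ->
  (\prod_i P (A i))%E = (\prod_i fine (P (A i)))%:E.
Proof.
move=> mA; rewrite -prodEFin; apply: eq_bigr => i _.
by rewrite fineK// fin_num_measure.
Qed.

Context (m : probability (Omega D) R) (hm : is_rtp_law m).

(** The law with A = [setT] identifies the probability of the innovation rectangle; the leaf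
    rectangle then contributes its own factor. The sets [B] see the innovations themselves, not only
    the induced maps. *)
Lemma rtp_law_rect n (s : leaves S n) (B : seq bool -> set E) :
  (forall u, measurable (B u)) ->
  m ([set w | leaves_at n [::] w = s] `&`
     [set w | forall u, (size u < n)%N -> B u (eps w u)]) =
  ((leaves_weight state_mass s)%:E * m [set w | forall u, (size u < n)%N -> B u (eps w u)])%E.
Proof.
move=> mB.
have mS (A : set S) : measurable A by exact: discrete_measurableP.
have -> : [set w : Omega D | forall u, (size u < n)%N -> B u (eps w u)] =
    [set w : Omega D | (forall u : seq bool, size u = n -> [set: S] (xi w u)) /\
               (forall u : seq bool, (size u < n)%N -> B u (eps w u))].
  by apply/seteqP; split=> w //= -[].
rewrite (hm n (A := fun=> setT))// big1 ?mul1e => [|u _]; last exact: probability_setT.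
rewrite -prod_leaf_set -prod_fine// -hm//.
congr (m _). apply/seteqP; split=> w /=.
  by move=> [/leaves_atP sP [_ BP]].
by move=> [sP BP]; split=> //; apply/leaves_atP.
Qed.

Lemma rtp_law_root n (g : innov S n) (s : leaves S n) :
  m ([set w | innov_at n [::] w = g] `&` [set w | leaves_at n [::] w = s]) =
  (innov_weight innov_mass g * leaves_weight state_mass s)%:E.
Proof.
have mS (A : set S) : measurable A by exact: discrete_measurableP.
rewrite mulrC EFinM -prod_leaf_set -prod_innov_set -prod_fine// -[X in (_ * X)%E]prodEFin.
have mI u : measurable (innov_set g u) := measurable_innov_set g u.
under [X in (_ * X)%E]eq_bigr do rewrite -prod_fine//.
rewrite -(hm n (A := leaf_set s) (B := innov_set g))//.
congr (m _); apply/seteqP; split=> w /=.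
  by move=> [/innov_atP gP /leaves_atP sP].
by move=> [sP gP]; split; [apply/innov_atP|apply/leaves_atP].
Qed.

End rtp_law.

(** * Approximation modulo null sets *)

Section sigma_algebra_approximation.
Context (R : realType) (d : measure_display) (T : measurableType d).
Context (P : probability T R).
Implicit Types (A B : set T) (G : set (set T)).

Definition ae_in G A := exists2 B, <<s G >> B & P.-negligible (A `+` B).

Lemma measurableY A B : measurable A -> measurable B -> measurable (A `+` B).
Proof. by move=> mA mB; apply: measurableU; exact: measurableD. Qed.

Lemma setY_bigcup (I : Type) (D : set I) (A B : I -> set T) :
  (\bigcup_(i in D) A i) `+` (\bigcup_(i in D) B i) `<=`
  \bigcup_(i in D) (A i `+` B i).
Proof.
move=> t [[[i Di Ait] nB]|[[i Di Bit] nA]]; exists i => //; [left|right]; split=> // h.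
  by apply: nB; exists i.
by apply: nA; exists i.
Qed.

Lemma setYCC A B : ~` A `+` ~` B = A `+` B.
Proof. by rewrite setYC /setY !setDE !setCK setIC [X in _ `|` X]setIC. Qed.

Section sub_sigma_algebra.
Context (G : set (set T)).
Hypothesis Gm : <<s G >> `<=` measurable.

(** Take B_k within 2^-(k+1) of A. A point where A and limsup B_k differ lies in infinitely many of
    the symmetric differences of A and B_k, and Borel-Cantelli makes such points negligible. *)
Lemma ae_in_approx A : measurable A ->
  (forall eta : R, 0 < eta -> exists2 B, <<s G >> B & (P (A `+` B) <= eta%:E)%E) ->
  ae_in G A.
Proof.
move=> mA approx.
have eta0 k : 0 < 1 / (2 ^ k.+1)%:R :> R by rewrite divr_gt0// ltr0n expn_gt0.
have /choice[B BP] : forall k, exists B, <<s G >> B /\ (P (A `+` B) <= (1 / (2 ^ k.+1)%:R)%:E)%E.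
  by move=> k; have [B ? ?] := approx _ (eta0 k); exists B.
have sB k : <<s G >> (B k) := (BP k).1.
have mAB k : measurable (A `+` B k) by apply: measurableY => //; exact: Gm.
exists (lim_sup_set B).
  apply: (@bigcap_measurableType _ (g_sigma_algebraType G)) => n _.
  by apply: (@bigcup_measurable _ (g_sigma_algebraType G)) => k _; exact: sB.
apply: (@negligibleS _ _ _ _ (lim_sup_set (fun k => A `+` B k))).
  move=> t [[At nB] n _|[Bt nAt] n _].
    apply: contrapT => nt; apply: nB => l _.
    exists (maxn n l); first exact: leq_maxr.
    apply: contrapT => nBt; apply: nt; exists (maxn n l); first exact: leq_maxl.
    by left.
  by have [k nk Bkt] := Bt n I; exists k => //; right.
apply/negligibleP.
  apply: bigcapT_measurable => n; exact: bigcup_measurable.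
apply: lim_sup_set_cvg0 => //; apply: (@le_lt_trans _ _ 1%:E); last exact: ltry.
apply: le_trans (epsilon_trick0 xpredT ler01).
by apply: lee_nneseries => k _ //; have [] := BP k.
Qed.

Lemma ae_in_sigma_algebra : sigma_algebra setT (ae_in G).
Proof.
split.
- exists set0; first exact: (@measurable0 _ (g_sigma_algebraType G)).
  by rewrite setYK; exact: negligible_set0.
- move=> A [B sB AB]; exists (~` B); first exact: (@measurableC _ (g_sigma_algebraType G)).
  by rewrite setTD setYCC.
- move=> A aeA; have /choice[B BP] : forall k, exists B, <<s G >> B /\ P.-negligible (A k `+` B).
    by move=> k; have [B] := aeA k; exists B.
  exists (\bigcup_k B k).
    by apply: (@bigcupT_measurable _ (g_sigma_algebraType G)) => k; exact: (BP k).1.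
  exact: negligibleS (@setY_bigcup _ _ _ _) (negligible_bigcup (fun k => (BP k).2)).
Qed.

(** X is rebuilt as the supremum of the rationals r with r < X: each event {r < X} is replaced by a
    version in the sub-sigma-algebra, and the countably many exceptional sets have a negligible
    union. *)
Lemma ae_in_fun (X : T -> R) : (forall r, ae_in G [set t | r < X t]) ->
  exists2 Y : T -> R, @measurable_fun _ _ (g_sigma_algebraType G) R setT Y &
    X = Y %[ae P].
Proof.
(* Indices that do not code a rational get level 0; [B k] is a version of {r k < X} for them too. *)
move=> aeX; pose r k : R := if unpickle k is Some q then ratr (q : rat) else 0.
have /choice[B BP] : forall k, exists B, <<s G >> B /\ P.-negligible ([set t | r k < X t] `+` B).
  by move=> k; have [B] := aeX (r k); exists B.
pose f k (t : g_sigma_algebraType G) : \bar R := if t \in B k then (r k)%:E else -oo%E.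
have mf k : @measurable_fun _ _ (g_sigma_algebraType G) (\bar R) setT (f k).
  apply: measurable_fun_ifT => //; apply: (measurable_fun_bool true).
  rewrite setTI (_ : _ @^-1` _ = B k); first by have [] := BP k.
  by apply/seteqP; split=> t; [exact: set_mem | exact: mem_set].
exists (fun t => fine (esups (f ^~ t) 0%N)).
  exact: measurableT_comp (measurable_fun_esups mf 0%N).
apply: negligibleS (negligible_bigcup (fun k => (BP k).2)) => t /= /not_implyP[_ XY].
apply: contrapT => nt; apply: XY.
have Bt k : (t \in B k) = (r k < X t).
  apply/idP/idP; rewrite inE => h; apply: contrapT => nh; apply: nt; exists k => //.
    by right; split.
  by left; split.
suff -> : esups (f ^~ t) 0%N = (X t)%:E by [].
apply/eqP; rewrite eq_le; apply/andP; split.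
  apply: ge_ereal_sup => _ [k _ <-]; rewrite /f Bt.
  by case: ifPn => [/ltW|_]; rewrite ?lee_fin ?leNye.
apply/lee_subgt0Pr => e e0; rewrite -EFinB.
have [|q /andP[]] := @rat_in_itvoo R (X t - e) (X t); first by rewrite ltrBlDr ltrDl.
rewrite !bnd_simp => qX Xq.
apply: (@le_trans _ _ (ratr q)%:E); first by rewrite lee_fin ltW.
apply: ereal_sup_ubound; exists (pickle q) => //.
by rewrite /f Bt /r pickleK Xq.
Qed.

End sub_sigma_algebra.

(** The approximable sets form a sigma-algebra containing [G]. For a countable union, all but
    finitely many sets are dropped at cost eta / 2, and the remaining approximants live at a common
    level since the sigma-algebras increase. *)
Lemma filtration_approx (F : nat -> set (set T)) G :
  (forall n, <<s F n >> `<=` measurable) ->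
  (forall n, <<s F n >> `<=` <<s F n.+1 >>) ->
  (forall A, G A -> exists n, <<s F n >> A) ->
  forall A, <<s G >> A -> forall eta : R, 0 < eta ->
  exists n, exists2 B, <<s F n >> B & (P (A `+` B) <= eta%:E)%E.
Proof.
move=> Fm Fn GF.
have Fle m n : (m <= n)%N -> <<s F m >> `<=` <<s F n >>.
  move=> /subnK <-; elim: (n - m)%N => [|k IH]; rewrite ?addSn//.
  by apply: subset_trans IH _; exact: Fn.
pose C A := measurable A /\ forall eta : R, 0 < eta ->
  exists n, exists2 B, <<s F n >> B & (P (A `+` B) <= eta%:E)%E.
suff CG : <<s G >> `<=` C by move=> A /CG[].
apply: smallest_sub; last first.
  move=> A /GF[n FA]; split=> [|eta eta0]; first exact: Fm FA.
  by exists n, A => //; rewrite setYK measure0 lee_fin ltW.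
split.
- split=> // eta eta0; exists 0%N, set0; last by rewrite setYK measure0 lee_fin ltW.
  exact: (@measurable0 _ (g_sigma_algebraType (F 0%N))).
- move=> A [mA Aapp]; split=> [|eta /Aapp[n [B FB AB]]]; first exact: measurableD.
  exists n, (~` B); last by rewrite setTD setYCC.
  exact: (@measurableC _ (g_sigma_algebraType (F n))).
move=> A CA; have mA k : measurable (A k) := (CA k).1.
split=> [|eta eta0]; first exact: bigcupT_measurable.
pose U N := \big[setU/set0]_(k < N) A k.
have mU N : measurable (U N) by apply: bigsetU_measurable => k _.
have [N PN] : exists N, (P ((\bigcup_k A k) `\` U N) <= (eta / 2)%:E)%E.
  pose V N := (\bigcup_k A k) `\` U N.
  have mV N : measurable (V N) by apply: measurableD => //; exact: bigcupT_measurable.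
  have V0 : \bigcap_N V N = set0.
    apply/seteqP; split=> // t Vt; have [[k _ Akt] _] := Vt 0%N I.
    have [_] := Vt k.+1 I; apply; rewrite /U -bigcup_mkord; exists k => //=.
  have : P \o V @ \oo --> P (\bigcap_N V N).
    apply: nonincreasing_cvg_mu => //; last first.
    - move=> a b ab; apply/subsetPset; apply: setDS; exact: subset_bigsetU.
    - by rewrite V0.
    - by rewrite (le_lt_trans (probability_le1 _ _))// ltry.
  rewrite V0 measure0 => /fine_cvgP[_ /cvgrPdist_lt /(_ (eta / 2))].
  case=> [|N _ NP]; first by rewrite divr_gt0.
  exists N; have /= := NP N (leqnn N); rewrite sub0r normrN ger0_norm ?fine_ge0// => PN.
  have fV : P (V N) \is a fin_num by rewrite fin_num_measure.
  by rewrite -/(V N) -(fineK fV) lee_fin ltW.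
(* N errors of this size sum to at most eta / 2; the successor covers N = 0. *)
have delta0 : 0 < eta / 2 / N.+1%:R by rewrite !divr_gt0// ltr0n.
have /choice[n nP] : forall k, exists n, exists B, <<s F n >> B /\ (P (A k `+` B) <= (eta / 2 / N.+1%:R)%:E)%E.
  by move=> k; have [n [B ? ?]] := (CA k).2 _ delta0; exists n, B.
have /choice[B BP] := nP.
exists (\max_(k < N) n k)%N; exists (\big[setU/set0]_(k < N) B k).
  apply: (@bigsetU_measurable _ (g_sigma_algebraType (F (\max_(k < N) n k)%N))) => k _.
  by apply: (Fle _ _ _ _ (BP k).1); exact: leq_bigmax.
have mAB k : measurable (A k `+` B k).
  by apply: measurableY => //; exact: Fm (BP k).1.
apply: (@le_trans _ _ (P (((\bigcup_k A k) `\` U N) `|` \big[setU/set0]_(k < N) (A k `+` B k)))).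
  apply: le_measure; rewrite ?inE.
  - apply: measurableY; first exact: bigcupT_measurable.
    by apply: bigsetU_measurable => k _; exact: Fm (BP k).1.
  - apply: measurableU; last exact: bigsetU_measurable.
    by apply: measurableD => //; exact: bigcupT_measurable.
  - rewrite /U -!bigcup_mkord -(bigcup_mkord N (fun k => A k `+` B k)).
    move=> t [[At nB]|[Bt nA]]; last have [k kN Bkt] := Bt.
      have [Ut|nUt] := pselect ((\bigcup_(k in `I_N) A k) t); last by left; split.
      right; have [k kN Akt] := Ut; exists k => //; left; split=> // Bkt.
      by apply: nB; exists k.
    right; exists k => //; right; split=> // Akt; apply: nA; exists k => //.
rewrite (le_trans (measureU2 _ _ _))//.
- by apply: measurableD => //; exact: bigcupT_measurable.
- exact: bigsetU_measurable.
rewrite [eta]splitr EFinD; apply: leeD; first exact: PN.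
apply: le_trans; first exact: (@Boole_inequality _ _ _ P (fun k => A k `+` B k) N).
apply: (@le_trans _ _ (\sum_(k < N) (eta / 2 / N.+1%:R)%:E)%E).
  by apply: lee_sum => k _; have [] := BP k.
rewrite sumEFin lee_fin sumr_const card_ord -[leLHS]mulr_natr mulrAC.
by rewrite ler_pdivrMr ?ltr0n// ler_wpM2l ?divr_ge0 ?(ltW eta0)// ler_nat.
Qed.

End sigma_algebra_approximation.

(** * Endogeny and the off-diagonal mass *)

Section endogeny.
Context (R : realType) (dS dE : measure_display).
Context (S : finMeasurableType dS) (E : measurableType dE) (D : rtp R S E).
Notation G := {ffun S * S -> S}.
Notation eps_events := (@eps_events R dS dE S E D).
Notation epsType := (g_sigma_algebraType eps_events).
Notation Sf := (S : finType).

Lemma eps_measurable_sub : <<s eps_events >> `<=` (measurable : set (set (Omega D))).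
Proof. by apply: sub_sigma_algebra2; exact: subsetUr. Qed.

Lemma eps_events_eps u (A : set E) :
  measurable A -> eps_events [set w | A (eps w u)].
Proof. by move=> mA; exists u => //; exists A => //; rewrite setTI. Qed.

Lemma measurable_xi u (A : set S) :
  measurable [set w : Omega D | A (xi w u)].
Proof.
apply: sub_sigma_algebra; left; exists u => //; exists A; last by rewrite setTI.
exact: discrete_measurableP.
Qed.

Lemma eps_measurable_innov_at n v (g : innov S n) :
  <<s eps_events >> [set w : Omega D | innov_at n v w = g].
Proof.
elim: n v g => [|n IH] v g.
  rewrite (_ : mkset _ = setT); first exact: (@measurableT _ epsType).
  by apply/seteqP; split=> // w _; case: g.
case: g => h [g0 g1].
rewrite (_ : mkset _ = [set w : Omega D | [set z | innov_map D z = h] (eps w v)] `&`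
    ([set w : Omega D | innov_at n (rcons v false) w = g0] `&` [set w : Omega D | innov_at n (rcons v true) w = g1])).
  apply: (@measurableI _ epsType); last by apply: (@measurableI _ epsType); exact: IH.
  by apply: sub_sigma_algebra; apply: eps_events_eps; exact: measurable_innov_map.
apply/seteqP; split=> w /=; first by move=> -[-> -> ->].
by move=> [-> [-> ->]].
Qed.

Lemma measurable_innov_at n v (g : innov S n) :
  measurable [set w : Omega D | innov_at n v w = g].
Proof. by apply: eps_measurable_sub; exact: eps_measurable_innov_at. Qed.

Lemma measurable_leaves_at n v (s : leaves S n) :
  measurable [set w : Omega D | leaves_at n v w = s].
Proof.
elim: n v s => [|n IH] v s; first exact: (measurable_xi v [set s]).
case: s => s0 s1.
rewrite (_ : mkset _ = [set w : Omega D | leaves_at n (rcons v false) w = s0] `&`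
   [set w : Omega D | leaves_at n (rcons v true) w = s1]); first by apply: measurableI; exact: IH.
by apply/seteqP; split=> w /= [-> ->].
Qed.

Lemma innov_xiE n v (t : innov S n * S) :
  [set w : Omega D | (innov_at n v w, xi w v) = t] =
  [set w | innov_at n v w = t.1] `&` [set w | xi w v = t.2].
Proof. by case: t => g x; apply/seteqP; split=> w /= [<- <-]. Qed.

Lemma measurable_innov_xi n v (Q : set (innov S n * S)) :
  measurable [set w : Omega D | Q (innov_at n v w, xi w v)].
Proof.
apply: (@finite_preimage_measurable _ _ _ (fun w : Omega D => (innov_at n v w, xi w v))) => t.
rewrite innov_xiE; apply: measurableI; first exact: measurable_innov_at.
exact: (measurable_xi v [set t.2]).
Qed.

Definition tree_at n v (w : Omega D) : innov S n * leaves S n :=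
  (innov_at n v w, leaves_at n v w).

Lemma tree_atE n v t : [set w | tree_at n v w = t] =
  [set w | innov_at n v w = t.1] `&` [set w | leaves_at n v w = t.2].
Proof. by case: t => g s; apply/seteqP; split=> w /= [<- <-]. Qed.

Lemma measurable_tree_at n v t : measurable [set w | tree_at n v w = t].
Proof.
by rewrite tree_atE; apply: measurableI; [exact: measurable_innov_at|exact: measurable_leaves_at].
Qed.

Context (m : probability (Omega D) R) (hm : is_rtp_law m).

Definition tree_weight n (t : innov S n * leaves S n) : R :=
  innov_weight (innov_mass D) t.1 * leaves_weight (state_mass D) t.2.

Lemma innov_weight_marginal n (b : bool) (g : innov S n) :
  \sum_(g' : innov S n.+1) innov_weight (innov_mass D) g' * ((if b then g'.2.2 else g'.2.1) == g)%:R =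
  innov_weight (innov_mass D) g.
Proof.
rewrite big_pair.
transitivity (\sum_(h : G) innov_mass D h * innov_weight (innov_mass D) g); last first.
  by rewrite -mulr_suml innov_mass_sum1 mul1r.
apply: eq_bigr => h _; rewrite big_pair /=.
transitivity (innov_mass D h * ((\sum_(g1 : innov S n) innov_weight (innov_mass D) g1 * (g1 == g)%:R) *
   (\sum_(g0 : innov S n) innov_weight (innov_mass D) g0))); last first.
  by rewrite sum_delta innov_weight_sum1 ?innov_mass_sum1// mulr1.
rewrite -mulr_sum2 mulr_sumr; case: b; first rewrite exchange_big /=;
  apply: eq_bigr => g1 _; rewrite mulr_sumr; apply: eq_bigr => g0 _; ring.
Qed.

Lemma leaves_weight_marginal n (b : bool) (s : leaves S n) :
  \sum_(s' : leaves S n.+1) leaves_weight (state_mass D) s' * ((if b then s'.2 else s'.1) == s)%:R =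
  leaves_weight (state_mass D) s.
Proof.
rewrite big_pair /=.
transitivity ((\sum_(s1 : leaves S n) leaves_weight (state_mass D) s1 * (s1 == s)%:R) *
   (\sum_(s0 : leaves S n) leaves_weight (state_mass D) s0)); last first.
  by rewrite sum_delta leaves_weight_sum1 ?state_mass_sum1// mulr1.
rewrite -mulr_sum2; case: b; first rewrite exchange_big /=;
  apply: eq_bigr => s1 _; apply: eq_bigr => s0 _; ring.
Qed.

(** The law is prescribed for trees at the root. A tree of depth n at a daughter of v is part of the
    tree of depth n+1 at v, so induction on the last letter and marginalisation reach every
    vertex. *)
Lemma tree_law n v (t : innov S n * leaves S n) :
  fine (m [set w | tree_at n v w = t]) = tree_weight t.
Proof.
elim/last_ind: v n t => [|v b IH] n t.
  by rewrite tree_atE rtp_law_root.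
pose Q (t' : innov S n.+1 * leaves S n.+1) :=
  ((if b then t'.1.2.2 else t'.1.2.1) == t.1) && ((if b then t'.2.2 else t'.2.1) == t.2).
have -> : [set w | tree_at n (rcons v b) w = t] = [set w | Q (tree_at n.+1 v w)].
  rewrite tree_atE; apply/seteqP; split=> w /=.
    by rewrite /Q; case: b {Q} => -[/= -> ->]; rewrite !eqxx.
  by rewrite /Q; case: b {Q} => /andP[/eqP <- /eqP <-].
rewrite (fine_measure_finite _ _ (@measurable_tree_at n.+1 v)).
under eq_bigr do rewrite IH.
rewrite big_mkcond big_pair /=.
transitivity (\sum_(g' : innov S n.+1) \sum_(s' : leaves S n.+1)
   (innov_weight (innov_mass D) g' * ((if b then g'.2.2 else g'.2.1) == t.1)%:R) *
   (leaves_weight (state_mass D) s' * ((if b then s'.2 else s'.1) == t.2)%:R)).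
  apply: eq_bigr => g' _; apply: eq_bigr => s' _; rewrite /Q /tree_weight /=.
  by case: eqP => _; case: eqP => _ /=; ring.
by rewrite mulr_sum2 innov_weight_marginal leaves_weight_marginal.
Qed.

Lemma xi_law n v (Q : pred S) :
  fine (m [set w | Q (xi w v)]) =
  \sum_(g : innov S n) \sum_(s : leaves S n)
    innov_weight (innov_mass D) g * leaves_weight (state_mass D) s * (Q (root_val g s))%:R.
Proof.
have := @fine_measure_finite _ _ _ m _ (tree_at n v)
  (fun t => Q (root_val t.1 t.2)) (@measurable_tree_at n v).
rewrite (_ : mkset _ = [set w | Q (xi w v)]); last first.
  by apply/seteqP; split=> w /=; rewrite root_val_at.
move=> ->; rewrite big_mkcond big_pair; apply: eq_bigr => g _; apply: eq_bigr => s _ /=.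
by rewrite tree_law; case: ifP => _; rewrite ?mulr1 ?mulr0.
Qed.

(** The law of the root value is computed from the trees of depth 0 and of depth 1. *)
Lemma state_mass_inv x :
  \sum_(h : G) innov_mass D h * \sum_a \sum_b state_mass D a * state_mass D b * (h (a, b) == x)%:R = state_mass D x.
Proof.
have := xi_law 0 [::] (pred1 x); rewrite (xi_law 1 [::]) big_innov0 /=.
under [RHS]eq_bigr do rewrite mul1r; rewrite sum_delta => <-.
rewrite [RHS]big_pair; apply: eq_bigr => h _; rewrite [RHS]big_pair !(@big_innov0 R S) /=.
rewrite [RHS]big_pair mulr_sumr; apply: eq_bigr => a _.
by rewrite mulr_sumr; apply: eq_bigr => b _ /=; rewrite !mulr1 !mulrA.
Qed.

Lemma innov_xi_law n v g x :
  fine (m ([set w | innov_at n v w = g] `&` [set w | xi w v = x])) =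
  innov_weight (innov_mass D) g * cond_law (state_mass D) g x.
Proof.
have := @fine_measure_finite _ _ _ m _ (tree_at n v)
  (fun t => (t.1 == g) && (root_val t.1 t.2 == x)) (@measurable_tree_at n v).
rewrite [X in fine (m X) = _](_ : _ = [set w | innov_at n v w = g] `&` [set w | xi w v = x]); last first.
  apply/seteqP; split=> w; rewrite /tree_at /= root_val_at.
    by move=> /andP[/eqP -> /eqP ->].
  by move=> [-> ->]; rewrite !eqxx.
move=> ->; rewrite big_mkcond big_pair (bigD1 g)//= [X in _ + X]big1 ?addr0 => [|g' /negbTE g'g].
  rewrite mulr_sumr; apply: eq_bigr => s _; rewrite eqxx tree_law /= mulrA.
  by case: ifP; rewrite ?mulr1 ?mulr0.
by rewrite big1// => s _; rewrite g'g.
Qed.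

(* The guess is the most likely root value given the innovations: its error
   probability is 1 - max q <= 1 - sum q^2, averaged over the innovations. *)
Lemma innov_guess n v : exists f : innov S n -> S,
  fine (m [set w | xi w v != f (innov_at n v w)]) <= off_mass (state_mass D) (innov_mass D) n.
Proof.
pose f (g : innov S n) : S := [arg max_(y > (point : S)) cond_law (state_mass D) g y]%O.
have fmax g y : cond_law (state_mass D) g y <= cond_law (state_mass D) g (f g).
  by rewrite /f; case: arg_maxP => // z _; exact.
exists f.
pose F (w : Omega D) : innov S n * S := (innov_at n v w, xi w v).
have mF t : measurable [set w | F w = t] by exact: (@measurable_innov_xi n v [set t]).
rewrite (fine_measure_finite m (fun t => t.2 != f t.1) mF) big_mkcond big_pair /=.
rewrite off_massE ?state_mass_sum1//; last exact: state_mass_inv.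
have -> : \sum_x (state_mass D x - coupling (state_mass D) (innov_mass D) n (x, x)) =
  \sum_(g : innov S n) innov_weight (innov_mass D) g *
    (1 - \sum_x cond_law (state_mass D) g x * cond_law (state_mass D) g x).
  rewrite sumrB state_mass_sum1 /coupling exchange_big /= -[X in X - _ = _](innov_weight_sum1 (innov_mass_sum1 D) n) -sumrB.
  by apply: eq_bigr => g _; rewrite mulrBr mulr1 mulr_sumr.
apply: ler_sum => g _.
have -> : \sum_x (if x != f g then fine (m [set w | F w = (g, x)]) else 0) =
   innov_weight (innov_mass D) g * (1 - cond_law (state_mass D) g (f g)).
  rewrite -(cond_law_sum1 (state_mass_sum1 D) g) [in RHS](bigD1 (f g))//= addrAC subrr add0r mulr_sumr.
  rewrite [RHS]big_mkcond; apply: eq_bigr => x _.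
  by rewrite innov_xiE innov_xi_law.
rewrite ler_wpM2l ?innov_weight_ge0//; first exact: innov_mass_ge0.
rewrite lerB// -[leRHS]mul1r -[X in _ <= X * _](cond_law_sum1 (state_mass_sum1 D) g) mulr_suml.
by apply: ler_sum => x _; rewrite ler_wpM2l// cond_law_ge0//; exact: state_mass_gt0.
Qed.

(** At every vertex, the state is guessed from the innovations below it with arbitrarily small
    error, so each event of [xi] is a.e. an innovation event. The events with this property form a
    sigma-algebra, hence include all measurable ones. *)
Lemma off_mass_endogenous :
  (forall eta, 0 < eta -> exists n, off_mass (state_mass D) (innov_mass D) n <= eta) ->
  endogenous m.
Proof.
move=> off0.
have ae_xi u (A : set S) : ae_in m eps_events [set w | A (xi w u)].
  apply: ae_in_approx; [exact: eps_measurable_sub|exact: measurable_xi|].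
  move=> eta /off0[n neta]; have [f fP] := innov_guess n u.
  exists [set w : Omega D | A (f (innov_at n u w))].
    apply: (@finite_preimage_measurable _ epsType _ (innov_at n u) [set g | A (f g)]) => g.
    exact: eps_measurable_innov_at.
  have mne : measurable [set w : Omega D | xi w u != f (innov_at n u w)].
    exact: (@measurable_innov_xi n u [set t | t.2 != f t.1]).
  have mAf : measurable [set w : Omega D | A (f (innov_at n u w))].
    apply: (@finite_preimage_measurable _ _ _ (innov_at n u) [set g | A (f g)]) => g.
    exact: measurable_innov_at.
  apply: (@le_trans _ _ (m [set w | xi w u != f (innov_at n u w)])).
    apply: le_measure; rewrite ?inE//.
      by apply: measurableY => //; exact: measurable_xi.
    by move=> w /= [[Ax nA]|[Ax nA]]; apply/eqP => xf; move: Ax nA; rewrite xf.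
  have fm : m [set w | xi w u != f (innov_at n u w)] \is a fin_num by rewrite fin_num_measure.
  by rewrite -(fineK fm) lee_fin (le_trans fP).
have ae_all : (measurable : set (set (Omega D))) `<=` ae_in m eps_events.
  apply: smallest_sub; first exact: ae_in_sigma_algebra.
  move=> A [[u _ [B _ <-]]|eA]; first by rewrite setTI; exact: ae_xi.
  exists A; first exact: sub_sigma_algebra.
  by rewrite setYK; exact: negligible_set0.
move=> X; apply: ae_in_fun => r; apply: ae_all.
rewrite (_ : mkset _ = [set: Omega D] `&` X @^-1` [set` `]r, +oo[]).
  by have := measurable_funPT X measurableT _ (measurable_itv `]r, +oo[); apply.
by rewrite setTI eqEsubset; split=> w /=; rewrite in_itv /= andbT.
Qed.

End endogeny.

(** * Endogeny forces concentration on the diagonal *)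

Section endogeny_necessary.
Context (R : realType) (dS dE : measure_display).
Context (S : finMeasurableType dS) (E : measurableType dE) (D : rtp R S E).
Notation eps_events := (@eps_events R dS dE S E D).
Notation epsType := (g_sigma_algebraType eps_events).

(** A pi-system generating the sigma-algebra of the innovations of the first n generations. *)
Definition eps_rect n : set (set (Omega D)) :=
  [set A | exists2 B : seq bool -> set E, (forall u, measurable (B u)) &
     A = [set w | forall u, (size u < n)%N -> B u (eps w u)]].

Lemma eps_rect_sub n : eps_rect n `<=` <<s eps_events >>.
Proof.
move=> _ [B mB ->].
(* The condition on all words becomes a countable intersection through their codes, the other
   indices contributing the whole space. *)
rewrite (_ : mkset _ = \bigcap_(k in [set: nat])
    (if unpickle k is Some u then
       if (size (u : seq bool) < n)%N then [set w : Omega D | B u (eps w u)] else [set: Omega D]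
     else [set: Omega D])).
  apply: (@bigcap_measurableType _ epsType) => k _.
  rewrite /=; case: ifP => _; last exact: (@measurableT _ epsType).
  by apply: sub_sigma_algebra; exact: eps_events_eps.
apply/seteqP; split=> w wB; last first.
  by move=> u un; have := wB (pickle u) I; rewrite pickleK un.
by move=> k _ /=; case: ifP => // /wB.
Qed.

Lemma eps_rect_measurable n : <<s eps_rect n >> `<=` (measurable : set (set (Omega D))).
Proof.
apply: subset_trans (@eps_measurable_sub _ _ _ _ _ D).
apply: smallest_sub; last exact: eps_rect_sub.
exact: smallest_sigma_algebra.
Qed.

Lemma eps_rect_setI n : setI_closed (eps_rect n).
Proof.
move=> _ _ [B mB ->] [C mC ->]; exists (fun u => B u `&` C u).
  by move=> u; exact: measurableI.
apply/seteqP; split=> w /=; first by move=> [wB wC] u un; split; [exact: wB|exact: wC].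
by move=> wBC; split=> u /wBC[].
Qed.

Lemma eps_rectT n : eps_rect n setT.
Proof. by exists (fun=> setT) => //; apply/seteqP; split. Qed.

Lemma eps_rect_le n k : (n <= k)%N -> <<s eps_rect n >> `<=` <<s eps_rect k >>.
Proof.
move=> nk; apply: sub_sigma_algebra2 => _ [B mB ->].
exists (fun u => if (size u < n)%N then B u else setT); first by move=> u; case: ifP.
apply/seteqP; split=> w /= wB u uk; first by case: ifP => // /wB.
by have := wB u (leq_trans uk nk); rewrite uk.
Qed.

Lemma eps_events_rect A : eps_events A -> exists n, <<s eps_rect n >> A.
Proof.
move=> [u _ [C mC <-]]; exists (size u).+1; apply: sub_sigma_algebra.
exists (fun v => if v == u then C else setT); first by move=> v; case: ifP.
rewrite setTI; apply/seteqP; split=> w /= wC; last by have := wC u (leqnn _); rewrite eqxx.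
by move=> v _; case: eqP => [->|].
Qed.

Lemma innov_at_rect n g : <<s eps_rect n >> [set w : Omega D | innov_at n [::] w = g].
Proof.
apply: sub_sigma_algebra; exists (innov_set D g).
  exact: measurable_innov_set.
apply/seteqP; split=> w /=; first by move/innov_atP.
by move=> wg; apply/innov_atP.
Qed.

Context (m : probability (Omega D) R) (hm : is_rtp_law m).

(** The restriction of [m] to the leaf event and a multiple of [m] agree on the pi-system
    [eps_rect n], hence on the sigma-algebra that it generates. *)
Lemma leaves_at_indep n s A : <<s eps_rect n >> A ->
  m ([set w | leaves_at n [::] w = s] `&` A) = ((leaves_weight (state_mass D) s)%:E * m A)%E.
Proof.
have w0 : 0 <= leaves_weight (state_mass D) s by apply: leaves_weight_ge0; exact: state_mass_gt0.
have mL := measurable_leaves_at (D := D) [::] s.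
pose m1 := mrestr m mL.
pose m2 := mscale (NngNum w0) m.
move=> sA; rewrite setIC.
apply: (@g_sigma_algebra_measure_unique _ R (Omega D) (eps_rect n) _ (fun=> setT) _ _ m1 m2 _ _ _ A sA).
- by move=> B /eps_rect_sub /eps_measurable_sub.
- by move=> _; exact: eps_rectT.
- by rewrite bigcup_const.
- exact: eps_rect_setI.
- by move=> _ [B mB ->]; have := rtp_law_rect hm s mB; rewrite setIC.
- by move=> _; rewrite (le_lt_trans (probability_le1 _ _)) ?ltry//; exact: measurableI.
Qed.

(** Once the induced maps [g] are known, further information on the innovations of the first n
    generations does not change the law of the root value. *)
Lemma innov_xi_indep n g x A : <<s eps_rect n >> A ->
  fine (m ([set w | innov_at n [::] w = g] `&` A `&` [set w | xi w [::] = x])) =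
  cond_law (state_mass D) g x * fine (m ([set w | innov_at n [::] w = g] `&` A)).
Proof.
move=> sA.
have sgA : <<s eps_rect n >> ([set w : Omega D | innov_at n [::] w = g] `&` A).
  by apply: (@measurableI _ (g_sigma_algebraType (eps_rect n))) => //; exact: innov_at_rect.
have mgA := eps_rect_measurable sgA.
have := @fine_measure_fiber _ _ _ m _ (leaves_at n [::]) _
  (fun s => root_val g s == x) mgA (measurable_leaves_at [::]).
set L := (X in fine (m X) = _); move=> LE.
rewrite [X in fine (m X) = _](_ : _ = L); last first.
  by apply/seteqP; split=> w [[/= gE Aw]]; rewrite -(root_val_at n) gE => /eqP.
rewrite LE mulr_suml big_mkcond; apply: eq_bigr => s _.
rewrite setIC leaves_at_indep// fineM ?fin_num_measure//=.
by case: ifP => _; rewrite ?mulr1 ?mulr0 ?mul0r.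
Qed.

Lemma innov_at_law n v g :
  fine (m [set w | innov_at n v w = g]) = innov_weight (innov_mass D) g.
Proof.
rewrite -[RHS]mulr1 -(cond_law_sum1 (state_mass_sum1 D) g) mulr_sumr.
under eq_bigr do rewrite -(innov_xi_law hm v).
have := @fine_measure_fiber _ _ _ m _ (fun w => xi w v) _ xpredT
  (measurable_innov_at v g) (fun x => measurable_xi v [set x]).
move=> <-; congr (fine (m _)).
by apply/seteqP; split=> w //= -[].
Qed.

(** On the event that the innovations are [g], let a and b be the masses outside and inside B, and q
    the conditional probability of x. The symmetric difference has mass q a + (1 - q) b there. This
    exceeds (a + b)(q - q^2), the contribution of [g] to the left-hand side, by a q^2 + b (1 -
    q)^2. *)
Lemma coupling_defect_le n x B : <<s eps_rect n >> B ->
  state_mass D x - coupling (state_mass D) (innov_mass D) n (x, x) <=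
  fine (m ([set w | xi w [::] = x] `+` B)).
Proof.
move=> sB; have mB := eps_rect_measurable sB.
have sC : <<s eps_rect n >> (~` B).
  exact: (@measurableC _ (g_sigma_algebraType (eps_rect n))).
have mx : measurable [set w : Omega D | xi w [::] = x] := measurable_xi [::] [set x].
have mY := measurableY mx mB.
have mg g : measurable [set w : Omega D | innov_at n [::] w = g] := measurable_innov_at [::] g.
have := @fine_measure_fiber _ _ _ m _ (innov_at n [::]) _ xpredT mY (measurable_innov_at [::]).
rewrite [X in fine (m X) = _](_ : _ = [set w | xi w [::] = x] `+` B); last first.
  by apply/seteqP; split=> w //= -[].
move=> ->.
rewrite -(cond_law_mean (state_mass_inv hm) n x) /coupling -sumrB; apply: ler_sum => g _ /=.
set q := cond_law _ g x.
have q0 : 0 <= q by apply: cond_law_ge0; exact: state_mass_gt0.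
have q1 : q <= 1.
  rewrite -(cond_law_sum1 (state_mass_sum1 D) g) (bigD1 x)//= lerDl sumr_ge0// => y _.
  by apply: cond_law_ge0; exact: state_mass_gt0.
pose a := fine (m ([set w | innov_at n [::] w = g] `&` ~` B)).
pose b := fine (m ([set w | innov_at n [::] w = g] `&` B)).
have a0 : 0 <= a by rewrite fine_ge0.
have b0 : 0 <= b by rewrite fine_ge0.
have split_at (X Y : set (Omega D)) : measurable X -> measurable Y ->
    fine (m X) = fine (m (X `&` Y)) + fine (m (X `&` ~` Y)).
  move=> mX mY'; rewrite -fine_measureU -?setIUr ?setUv ?setIT//.
  - exact: measurableI.
  - by apply: measurableI => //; exact: measurableC.
  - by rewrite setIACA setICr setI0.
have wE : innov_weight (innov_mass D) g = b + a.
  by rewrite /a /b -split_at// innov_at_law.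
have -> : fine (m (([set w | xi w [::] = x] `+` B) `&` [set w | innov_at n [::] w = g])) =
    q * a + (b - q * b).
  rewrite -(innov_xi_indep g x sC) -(innov_xi_indep g x sB) -/a -/b.
  rewrite /b (split_at _ _ (measurableI _ _ (mg g) mB) mx) addrAC subrr add0r -fine_measureU.
  - congr (fine (m _)); apply/seteqP; split=> w /=; tauto.
  - by apply: measurableI => //; apply: measurableI => //; exact: measurableC.
  - by apply: measurableI; [exact: measurableI|exact: measurableC].
  - by apply/seteqP; split=> // w /= [[_ ?] [_ ?]].
have qa0 : 0 <= a * q ^+ 2 by rewrite mulr_ge0 ?sqr_ge0.
have qb0 : 0 <= b * (1 - q) ^+ 2 by rewrite mulr_ge0 ?sqr_ge0.
by rewrite wE -subr_ge0 (_ : _ - _ = a * q ^+ 2 + b * (1 - q) ^+ 2) ?addr_ge0//; ring.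
Qed.

(** Endogeny applied to the indicator of {xi = x} at the root makes this event a.e. an innovation
    event, which is then approximated by one of finitely many generations. *)
Lemma endogenous_coupling : endogenous m ->
  forall eta, 0 < eta -> exists n0, forall n, (n0 <= n)%N ->
    forall x, state_mass D x - coupling (state_mass D) (innov_mass D) n (x, x) <= eta.
Proof.
move=> endo eta eta0.
suff /choice[N NP] : forall x, exists N, exists2 B, <<s eps_rect N >> B &
    (m ([set w | xi w [::] = x] `+` B) <= eta%:E)%E.
  (* One level serves all of the finitely many states, and so does every later one since the
     sigma-algebras increase. *)
  exists (\max_x N x)%N => n Nn x; have [B sB mB] := NP x.
  have sBn : <<s eps_rect n >> B.
    by apply: eps_rect_le sB; apply: leq_trans Nn; exact: leq_bigmax.
  apply: (le_trans (coupling_defect_le x sBn)).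
  rewrite -lee_fin fineK// fin_num_measure//; apply: measurableY.
    exact: (measurable_xi [::] [set x]).
  exact: eps_rect_measurable sBn.
move=> x.
have mx : measurable [set w : Omega D | xi w [::] = x] := measurable_xi [::] [set x].
have [Y mY XY] := endo (mindic R mx).
pose B0 := Y @^-1` [set 1].
have sB0 : <<s eps_events >> B0.
  by have := mY measurableT [set 1] (measurable_set1 _); rewrite setTI.
have B0_neg : m.-negligible ([set w | xi w [::] = x] `+` B0).
  apply: negligibleS XY => w /= h /(_ I); rewrite mindicE => XYw.
  case: h => -[]; first by move=> xw; apply; rewrite /B0 /= -XYw mem_set.
  move=> Yw nxw; move: XYw; rewrite Yw memNset// => /eqP.
  by rewrite eq_sym oner_eq0.
have [n [B sB mB]] := filtration_approx m (@eps_rect_measurable)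
  (fun n => eps_rect_le (leqnSn n)) eps_events_rect sB0 eta0.
exists n, B => //.
have mB0 := eps_measurable_sub sB0; have mB' := eps_rect_measurable sB.
have mxB0 := measurableY mx mB0; have mB0B := measurableY mB0 mB'.
apply: (@le_trans _ _ (m (([set w | xi w [::] = x] `+` B0) `|` (B0 `+` B)))).
  apply: le_measure; rewrite ?inE; [exact: measurableY|exact: measurableU|].
  move=> w /= [[xw nB]|[Bw nx]]; have [B0w|nB0w] := pselect (B0 w); [right|left|left|right];
    by [left|right].
apply: (le_trans (measureU2 m mxB0 mB0B)).
by rewrite (proj1 (negligibleP m mxB0) B0_neg) add0e.
Qed.

End endogeny_necessary.

(** * The matrix P^(-) *)

Section offdiagonal_matrix.
Context (R : realType) (dS dE : measure_display).
Context (S : finMeasurableType dS) (E : measurableType dE) (D : rtp R S E).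
Notation A := (Pminus D).
Notation n := #|{: offdiag S}|.

(** Extension by 0 to the diagonal, under which P^(-) on vectors corresponds to P^(2) on functions:
    the diagonal is absorbing and contributes nothing. *)
Definition pair_fun (v : 'cV[R]_n) (p : S * S) : R :=
  if insub p is Some o then v (enum_rank (o : offdiag S)) 0 else 0.

Lemma pair_fun_diag v x : pair_fun v (x, x) = 0.
Proof. by rewrite /pair_fun insubF//= eqxx. Qed.

Lemma pair_fun_val v (o : offdiag S) : pair_fun v (val o) = v (enum_rank o) 0.
Proof. by rewrite /pair_fun valK. Qed.

Lemma offdiag_val p : p.1 != p.2 -> exists o : offdiag S, val o = p.
Proof. by move=> pn; exists (Sub p pn); rewrite SubK. Qed.

Lemma Pminus_ge0 i j : 0 <= A i j.
Proof. by rewrite mxE sumr_ge0// => x _; rewrite mulr_ge0// fine_ge0. Qed.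

Lemma pair_fun_mulmx v p :
  pair_fun (A *m v) p = pair_op (state_mass D) (innov_mass D) (pair_fun v) p.
Proof.
have [/offdiag_val[ o <-] | ] := boolP (p.1 != p.2); last first.
  case: p => x y /=; rewrite negbK => /eqP <-.
  by rewrite pair_fun_diag pair_op_diag// => z; exact: pair_fun_diag.
rewrite pair_fun_val mxE -P2_pair_op.
rewrite (reindex (@enum_rank (offdiag S))) /=; last by apply: onW_bij; exact: fintype.enum_rank_bij.
transitivity (\sum_(o' : offdiag S) P2 D (val o) (val o') * pair_fun v (val o')).
  by apply: eq_bigr => o' _; rewrite mxE !enum_rankK pair_fun_val.
rewrite [RHS](bigID (fun q : S * S => q.1 != q.2))/= [X in _ + X]big1 ?addr0.
  exact/esym/(big_sub (fun q : S * S => q.1 != q.2)).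
by case=> x y; rewrite negbK => /eqP /= ->; rewrite pair_fun_diag mulr0.
Qed.

Lemma pair_fun_ge0 (v : 'cV[R]_n) p : (forall i, 0 <= v i 0) -> 0 <= pair_fun v p.
Proof. by move=> v0; rewrite /pair_fun; case: insubP. Qed.

Lemma pair_fun_gt0 (v : 'cV[R]_n) p : (forall i, 0 < v i 0) -> p.1 != p.2 -> 0 < pair_fun v p.
Proof. by move=> v0 /offdiag_val[ o <-]; rewrite pair_fun_val. Qed.

Lemma pair_fun_mulX (v : 'cV[R]_n) k p :
  pair_fun (A ^+ k *m v) p = iter k (pair_op (state_mass D) (innov_mass D)) (pair_fun v) p.
Proof.
elim: k p => [|k IH] p; first by rewrite expr0 mul1mx.
rewrite exprS -mulmxE -mulmxA pair_fun_mulmx /=; congr (pair_op _ _ _ p).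
by apply/funext => q; exact: IH.
Qed.

Lemma pair_fun_delta (o : offdiag S) q :
  pair_fun (delta_mx (enum_rank o) 0) q = (q == val o)%:R.
Proof.
have [/offdiag_val[ o' <-] | ] := boolP (q.1 != q.2).
  by rewrite pair_fun_val mxE andbT (inj_eq enum_rank_inj) (inj_eq val_inj).
case: q => x y /=; rewrite negbK => /eqP <-; rewrite pair_fun_diag.
by case: eqP => // xE; have := valP o; rewrite /= -xE eqxx.
Qed.

(** The supremum of the empty set is 0, so a nonzero value reveals a real eigenvalue. *)
Lemma largest_eigenvalue_neq0 : largest_eigenvalue A != 0 ->
  eigenvalue A (largest_eigenvalue A).
Proof.
move=> r0; have [|nA] := pselect (exists a, eigenvalue A a).
  by move=> [a /largest_eigenvalueP[]].
move/eqP: r0; case; rewrite /largest_eigenvalue (_ : mkset _ = set0) ?sup0//.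
by apply/seteqP; split=> // a ea; apply: nA; exists a.
Qed.

Lemma largest_eigenvalue_lt s :
  largest_eigenvalue A < s -> ~~ eigenvalue A s.
Proof.
move=> rs; apply/negP => es.
by have [_ /(_ _ es)] := largest_eigenvalueP es; rewrite leNgt rs.
Qed.

(** Otherwise h(x, b) = h(b, b) for every map h of positive mass. The copies would then merge in one
    step and P^(-) would vanish, against its positive eigenvalue. *)
Lemma innov_discrepancy :
  eigenvalue A (largest_eigenvalue A) -> 0 < largest_eigenvalue A ->
  exists o : offdiag S,
    0 < \sum_h innov_mass D h * (h (val o) != h ((val o).2, (val o).2))%:R.
Proof.
set r := largest_eigenvalue A => er r0; apply: contrapT => /forallNP no.
have h_eq (h : {ffun S * S -> S}) : innov_mass D h != 0 -> forall x b, h (x, b) = h (b, b).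
  move=> hn0 x b; apply: contrapT => /eqP hxb.
  have xb : x != b by apply: contra_neq hxb => ->.
  apply: (no (Sub (x, b) xb)); rewrite SubK /= (bigD1 h)//= hxb mulr1.
  apply: ltr_pwDl; first by rewrite lt_neqAle eq_sym hn0 innov_mass_ge0.
  by rewrite sumr_ge0// => h' _; rewrite mulr_ge0// innov_mass_ge0.
have A0 w : A *m w = 0 :> 'cV[R]_n.
  apply/colP => i; rewrite -[i]enum_valK -pair_fun_val pair_fun_mulmx mxE.
  rewrite /pair_op big1// => b _; rewrite big1 ?mulr0// => h _.
  have [->|hn0] := eqVneq (innov_mass D h) 0; first by rewrite mul0r.
  by rewrite !(h_eq _ hn0 _ b) pair_fun_diag mulr0.
have [w [w0 wn0 rw]] := eigenvalue_subharmonic Pminus_ge0 (ltW r0) er.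
move/eqP: wn0; apply; apply/colP => i; rewrite mxE.
apply/eqP; rewrite eq_le w0 andbT -(pmulr_rle0 _ r0).
by rewrite (le_trans (rw i))// A0 mxE.
Qed.

End offdiagonal_matrix.

(** * Assembly of the three regimes *)

Theorem theorem1 (R : realType) (dS dE : measure_display)
    (S : finMeasurableType dS) (E : measurableType dE) (D : rtp R S E)
    (m : probability (Omega D) R) (hm : is_rtp_law m) :
  [/\ 2 * largest_eigenvalue (Pminus D) < 1 -> endogenous m,
      1 < 2 * largest_eigenvalue (Pminus D) -> ~ endogenous m &
      2 * largest_eigenvalue (Pminus D) = 1 ->
      L2_root m `&` L2_orth m (L2_eps m) = L2_zero m ->
      irreducible_mx (Pminus D) ->
      endogenous m].
Proof.
set r := largest_eigenvalue (Pminus D).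
have mug := state_mass_gt0 D; have mus := state_mass_sum1 D; have nug := innov_mass_ge0 D.
have nus := innov_mass_sum1 D; have nusym := @innov_mass_sym _ _ _ _ _ D; have mui := state_mass_inv hm.
split=> [r1|r1 endo|r1 _ irr].
- apply: (off_mass_endogenous hm).
  (* The midpoint of max(r, 0) and 1/2 is positive, exceeds every real eigenvalue and satisfies 2 t
     < 1. *)
  pose t := (Num.max r 0 + 2^-1) / 2.
  have max_lt : Num.max r 0 < 2^-1 by rewrite gt_max; apply/andP; split; lra.
  have r_max : r <= Num.max r 0 by rewrite le_max lexx.
  have max_ge0 : 0 <= Num.max r 0 by rewrite le_max lexx orbT.
  have t0 : 0 < t by rewrite /t; lra.
  have [s ts|x [x0 Ax]] := @strict_superharmonic_exists _ _ _ (Pminus_ge0 D) t t0.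
    by apply: largest_eigenvalue_lt; rewrite (lt_le_trans _ ts)// /t -/r; lra.
  apply: (@subcritical_off_mass _ _ _ _ mug mus nug nusym mui (pair_fun x) t t0).
  + by rewrite /t; lra.
  + exact: pair_fun_diag.
  + by move=> p; exact: pair_fun_gt0.
  + move=> p /offdiag_val[ o <-]; rewrite -pair_fun_mulmx !pair_fun_val.
    exact: ltW.
- have r0 : 0 < r by lra.
  have er := largest_eigenvalue_neq0 (lt0r_neq0 r0).
  have [w [w0 wn0 rw]] := eigenvalue_subharmonic (Pminus_ge0 D) (ltW r0) er.
  have [i wi] : exists i, 0 < w i 0.
    apply: contrapT => /forallNP nw; move/eqP: wn0; apply; apply/colP => i.
    by rewrite mxE; apply/eqP; rewrite eq_le w0 andbT leNgt; apply/negP/nw.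
  apply: (@supercritical_coupling _ _ _ _ mug mus nug nus nusym mui
    (pair_fun w) r (val (enum_val i)) r1).
  + by move=> p; exact: pair_fun_ge0.
  + exact: pair_fun_diag.
  + by rewrite pair_fun_val enum_valK.
  + move=> p; rewrite -pair_fun_mulmx; have [/offdiag_val[ o <-] | ] := boolP (p.1 != p.2).
      by rewrite !pair_fun_val.
    by case: p => x y /=; rewrite negbK => /eqP <-; rewrite !pair_fun_diag mulr0.
  + exact: endogenous_coupling hm endo.
- apply: (off_mass_endogenous hm).
  have rE : r = 2^-1 by lra.
  have r0 : 0 < r by lra.
  have er := largest_eigenvalue_neq0 (lt0r_neq0 r0).
  (* At criticality a strict supersolution at level 1/2 is impossible; irreducibility provides a
     positive eigenvector instead. *)
  have [v [v0 Av]] := perron_irreducible (Pminus_ge0 D) r0 irr er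
    (@largest_eigenvalue_lt _ _ _ _ _ D).
  have [ o oP] := innov_discrepancy er r0.
  apply: (@critical_off_mass _ _ _ _ mug mus nug nus nusym mui (pair_fun v)
    (val o).1 (val o).2).
  + exact: pair_fun_diag.
  + by move=> p; exact: pair_fun_gt0.
  + move=> p /offdiag_val[ o' <-]; rewrite -pair_fun_mulmx !pair_fun_val -rE.
    by rewrite Av.
  + exact: valP o.
  + by rewrite -surjective_pairing.
  (* The entry of the k-th power at (o', o) is the k-th iterate of P^(2) on the indicator of [o],
     evaluated at o'. *)
  + move=> p /offdiag_val[ o' <-]; have [k _ kP] := irr (enum_rank o') (enum_rank o).
    exists k; rewrite -surjective_pairing.
    have -> : (fun q => (q == val o)%:R) = pair_fun (delta_mx (enum_rank o) 0) :> (S * S -> R).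
      by apply/funext => q; rewrite pair_fun_delta.
    by rewrite -pair_fun_mulX pair_fun_val -colE mxE.
Qed.
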